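(* There is an absolute constant $C>0$ such that the following holds. Let $\mathcal{N}$ be a von Neumann algebra with a normal faithful normalized trace $\tau$, and let $x_1,\dots,x_m\in\mathcal{N}$ be positive operators such that (i) $\frac1m\sum_{j=1}^m x_j=1$; (ii) $\|x_j\|\le r$ for all $j$. Let $\delta_1,\dots,\delta_m$ be independent selectors with $\mathbb{E}\delta_j=k/m$, where $0<k\le m$. Then for every $p\ge 2.5$ (with $p<\infty$), $$\left(\mathbb{E}\Big\|\frac1k\sum_{j=1}^m\delta_jx_j-1\Big\|_{L_p(\tau)}^p\right)^{1/p}\le C\max\left\{\sqrt{\frac{pr}{k}},\ \frac{pr}{k}\right\}.$$ Moreover, if $\operatorname{tr}$ is a (normal, faithful, finite) trace on $\mathcal{N}$ such that $\|x\|_{L_\infty(\operatorname{tr})}\le\|x\|_{L_p(\operatorname{tr})}$ for all $x\in\mathcal{N}$ and all finite $p\geq 1$, and if $r/k=\varepsilon^2$ with $\varepsilon>0$, then for $t>0$ with $t^2\ge 2.5\,C^2e$ and $t\ge 2.5\,Ce\varepsilon$, $$\operatorname{Prob}\left(\Big\|\frac1k\sum_{j=1}^m\delta_jx_j-1\Big\|_{L_\infty(\operatorname{tr})}>t\varepsilon\right)\le\operatorname{tr}(1)\cdot\begin{cases}e^{-t^2/(2C^2e)},&\text{if }t\varepsilon\le C,\\ e^{-t/(2Ce\varepsilon)},&\text{if }t\varepsilon\ge C.\end{cases}$$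
   Context: A selector is a $\{0,1\}$-valued (classical) random variable, and $\mathbb{E}$, $\operatorname{Prob}$ are taken over the probability space of the $\delta_j$. A normalized trace satisfies $\tau(1)=1$, $\tau(xy)=\tau(yx)$. For a trace $\omega\in\{\tau,\operatorname{tr}\}$, $\|x\|_{L_p(\omega)}=[\omega(|x|^p)]^{1/p}$ for $1\le p<\infty$ and $\|\cdot\|_{L_\infty(\omega)}=\|\cdot\|$ is the operator norm. Here $e$ is the base of natural logarithms. *)

(* Defs.v *)
From HB Require Import structures.
From mathcomp Require Import all_boot all_order all_algebra.
From mathcomp Require Import complex.
From mathcomp Require Import all_classical all_reals all_analysis.

Set Implicit Arguments.
Unset Strict Implicit.
Unset Printing Implicit Defensive.

Import Order.TTheory GRing.Theory Num.Theory.
Import numFieldNormedType.Exports.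

Local Open Scope classical_set_scope.
Local Open Scope ring_scope.

(* A complex Hilbert space is a complete normed space H over R[i] together with
   a positive definite hermitian form ip such that ip v v = `|v| ^+ 2. The norm
   of H takes its values in R[i], and z <= z' in R[i] means that z' - z is a
   nonnegative real. Operators are plain functions H -> H; the product of
   operators is \o and the unit is idfun. *)
Section Operators.
Variables (R : realType) (H : completeNormedModType R[i]).
Variable ip : {dot H for (@Num.conj R[i])}.

Implicit Types (a b x y z : H -> H) (A D N : set (H -> H)).

Definition bounded_op x : Prop :=
  linear x /\ exists M : R, forall v, `|x v| <= M%:C%C * `|v|.

Definition op_norm x : R :=
  sup [set complex.Re `|x v| | v in [set v : H | `|v| <= 1]].

(* The adjoint exists and is unique for bounded x (Riesz); 0 is a junk value. *)
Definition adjoint x : H -> H :=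
  xget (0 : H -> H)
    [set y | bounded_op y /\ forall u v, ip (x u) v = ip u (y v)].

Definition positive_op x : Prop := forall v, 0 <= ip (x v) v.

Definition le_op x y : Prop := positive_op (y - x).

(* |x|, the positive square root of x^* x. *)
Definition abs_op x : H -> H :=
  xget (0 : H -> H)
    [set a | [/\ bounded_op a, positive_op a & a \o a = adjoint x \o x]].

Definition poly_op (q : {poly R}) a : H -> H :=
  fun v => \sum_(i < size q) (q`_i)%:C%C *: iter i a v.

(* Continuous functional calculus f(a) for a positive bounded operator a: the
   norm limit of q(a) for real polynomials q converging to f uniformly on
   [0, ||a||], an interval which contains the spectrum of a. *)
Definition fun_calc (f : R -> R) a : H -> H :=
  xget (0 : H -> H)
    [set b | bounded_op b /\
       forall e : R, 0 < e -> exists q : {poly R},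
         (forall s : R, 0 <= s <= op_norm a -> `|q.[s] - f s| <= e) /\
         op_norm (poly_op q a - b) <= e].

Definition commutant A : set (H -> H) :=
  [set x | bounded_op x /\ forall y, A y -> x \o y = y \o x].

(* A von Neumann algebra on H: a unital *-subalgebra of the bounded operators
   which is equal to its double commutant. *)
Record von_neumann_algebra N : Prop := {
  vna_bounded : forall x, N x -> bounded_op x ;
  vna_unit : N idfun ;
  vna_lin : forall (c : R[i]) x y, N x -> N y -> N (c *: x + y) ;
  vna_mul : forall x y, N x -> N y -> N (x \o y) ;
  vna_adjoint : forall x, N x -> N (adjoint x) ;
  vna_bicommutant : commutant (commutant N) = N }.

Definition directed D : Prop :=
  D !=set0 /\
  forall x y, D x -> D y -> exists z, [/\ D z, le_op x z & le_op y z].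

(* z is the least upper bound of D among the self-adjoint elements of N. *)
Definition is_lub_in N D z : Prop :=
  [/\ N z /\ adjoint z = z,
      forall y, D y -> le_op y z &
      forall y, N y -> adjoint y = y -> (forall x, D x -> le_op x y) ->
        le_op z y].

(* A normal faithful finite trace on N. Only the values of tau on N matter. *)
Record nff_trace N (tau : (H -> H) -> R[i]) : Prop := {
  trace_lin : forall (c : R[i]) x y, N x -> N y ->
    tau (c *: x + y) = c * tau x + tau y ;
  trace_ge0 : forall x, N x -> positive_op x -> 0 <= tau x ;
  trace_comm : forall x y, N x -> N y -> tau (x \o y) = tau (y \o x) ;
  trace_faithful : forall x, N x -> positive_op x -> tau x = 0 -> x = 0 ;
  trace_normal : forall D z,
    (forall x, D x -> N x /\ positive_op x) -> directed D -> is_lub_in N D z ->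
    complex.Re (tau z) = sup [set complex.Re (tau x) | x in D] }.

Definition normalized (tau : (H -> H) -> R[i]) : Prop := tau idfun = 1.

(* ||x||_{L_p(tau)} for x in N and 1 <= p <= +oo. *)
Definition nc_Lnorm (tau : (H -> H) -> R[i]) (p : \bar R) x : R :=
  match p with
  | p%:E => complex.Re (tau (fun_calc (fun s => s `^ p) (abs_op x))) `^ p^-1
  | +oo%E => op_norm x
  | -oo%E => 0
  end.

End Operators.

Section Probability.
Context (d : measure_display) (T : measurableType d) (R : realType).
Variable P : probability T R.

Definition selector (X : {RV P >-> R}) : Prop := forall w, X w = 0 \/ X w = 1.

Definition independent (I : finType) (X : I -> {RV P >-> R}) : Prop :=
  forall (J : {set I}) (A : I -> set R), (forall i, measurable (A i)) ->
    P (\bigcap_(i in [set` J]) X i @^-1` A i) =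
    (\prod_(i in J) P (X i @^-1` A i))%E.

End Probability.

Definition sample_dev (R : realType) (H : completeNormedModType R[i]) (m : nat)
    (k : R) (x : 'I_m -> H -> H) (s : 'I_m -> R) : H -> H :=
  (k^-1)%:C%C *: (\sum_(j < m) (s j)%:C%C *: x j) - idfun.

(* Main.v *)
Require Import Defs.
From HB Require Import structures.
From mathcomp Require Import all_boot all_order all_algebra.
From mathcomp Require Import complex.
From mathcomp Require Import all_classical all_reals all_analysis.
From mathcomp Require Import zify ring lra.

Set Implicit Arguments.
Unset Strict Implicit.
Unset Printing Implicit Defensive.

Import Order.TTheory GRing.Theory Num.Theory.
Import numFieldNormedType.Exports.

Local Open Scope classical_set_scope.
Local Open Scope ring_scope.

(** Put rho = r / k, kappa = k / m and let Y_J be the deviation of the sample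
    when J is the selected set, so that Y_J is the sum of the centered terms
    (1_(j in J) - kappa) y_j with y_j = x_j / k, 0 <= y_j <= rho and
    kappa * (sum of the y_j) = 1.

    Everything comes from a recursion for the even moments
    M_(2q) = E tau(Y ^ 2q). Write Y ^ (2q+2) as the sum over j of
    (1_(j in J) - kappa) y_j Y ^ (2q+1) and average over the j-th selector
    alone: this leaves kappa (1 - kappa) tau(y_j (Y_+ ^ n - Y_- ^ n)), where
    n = 2q+1 and Y_+ - Y_- = y_j. Powers do not commute with y_j, but the trace
    does satisfy a mean value inequality for odd n,
      tau((a - b) (a ^ n - b ^ n)) <= n tau((a - b)^2 (a ^ (n-1) + b ^ (n-1)))
    (trace_power_difference). It holds because tau(d a^i d b^(n-1-i)) is
    midpoint convex in i along even i, by the Cauchy-Schwarz inequality of the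
    trace, so that each such word is at most the sum of the two extreme ones.
    With y_j ^ 2 <= rho y_j the squares sum up to Y again:
      M_(2q+2) <= n rho (M_(2q+1) + 2 M_(2q)),
    and the odd moment is absorbed by tau(Y^q (Y - n rho)^2 Y^q) >= 0. Hence
    M_(2q) <= ((n rho)^2 + 4 n rho)^q tau(1) (sample_moment_le), which for
    2q ~ p is already the moment bound.

    For real p, let 2q be the first even integer above p. By Young's inequality
    s^p is at most a combination of s^(2q) and 1, so it remains to see that the
    functional calculus of |Y| respects this inequality and lands in the algebra.
    The key is that a polynomial which is positive on [0, M] takes positive
    values at an operator a with 0 <= a <= M (num_peval_ge0). If the lower bound
    l of the numerical range of q(a) were negative, then q - l would have all
    its complex roots off [0, M]; each factor a - z, hence q(a) - l, would be
    bounded below, which for a positive operator pushes its numerical range away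
    from 0 and contradicts the choice of l. Consequently |Y| is a norm limit of
    polynomials in Y^2, hence commutes with the commutant and belongs to the
    algebra by the bicommutant property (sqrt_in_vna); the same reasoning
    applies to |Y|^p.

    The tail bound is Markov's inequality for the p-th moment, with
    p = t^2 / (C^2 e) or p = t / (C e eps). Only upper bounds of the
    noncommutative norms enter, so wherever the square root or the functional
    calculus is defined by choice the default value 0 satisfies the bound as
    well. *)

(** * Averages over a random subset *)

Section BernoulliMean.
Variables (R : realDomainType) (I : finType) (kap : R).
Implicit Types (J : {set I}) (F G : {set I} -> R) (j : I).

(** For [kap] in [0, 1], the law of a subset which contains each element
    independently with probability [kap]. *)
Definition bern_weight J := \prod_i (if i \in J then kap else 1 - kap).

Definition bern_mean F := \sum_J bern_weight J * F J.

Lemma bern_meanD F G :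
  bern_mean (fun J => F J + G J) = bern_mean F + bern_mean G.
Proof. by rewrite -big_split; apply: eq_bigr => J _ /=; rewrite mulrDr. Qed.

Lemma bern_meanZ c F : bern_mean (fun J => c * F J) = c * bern_mean F.
Proof. by rewrite mulr_sumr; apply: eq_bigr => J _; rewrite mulrCA. Qed.

Lemma bern_mean_sum (T : finType) (F : T -> {set I} -> R) :
  bern_mean (fun J => \sum_t F t J) = \sum_t bern_mean (F t).
Proof. by rewrite exchange_big; apply: eq_bigr => J _; rewrite mulr_sumr. Qed.

Lemma bern_mean_cst c : bern_mean (fun=> c) = c.
Proof.
rewrite /bern_mean -mulr_suml -[RHS]mul1r; congr (_ * c).
rewrite -(@bigA_distr _ _ _ _ _ _ (fun=> kap) (fun=> 1 - kap)) /=.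
by rewrite big1 // => i _; rewrite addrC subrK.
Qed.

(** Re-drawing the membership of [j] alone does not change the average: this is
    how independence is used in the moment recursion. *)
Lemma bern_mean_resample j F :
  bern_mean F =
  bern_mean (fun J => kap * F (j |: J) + (1 - kap) * F (J :\ j)).
Proof.
have split_at G :
    \sum_J G J = \sum_(J : {set I} | j \notin J) (G J + G (j |: J)).
  rewrite big_split /= addrC (bigID (fun J : {set I} => j \in J)) /=.
  congr (_ + _).
  rewrite (reindex_onto (fun J => j |: J) (fun J => J :\ j)) /=; last first.
    by move=> J jJ; rewrite finset.setD1K.
  apply: eq_bigl => J; rewrite finset.setU11 /=; apply/eqP/idP => [<-|jJ].
    by rewrite finset.setD11.
  by rewrite finset.setU1K.
rewrite /bern_mean !split_at; apply: eq_bigr => J jJ.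
have -> : j |: (j |: J) = j |: J by rewrite finset.setUA finset.setUid.
have -> : (j |: J) :\ j = J by rewrite finset.setU1K.
have -> : J :\ j = J.
  by apply/finset.setDidPl; rewrite disjoint_sym disjoints1.
pose W := \prod_(i | i != j) (if i \in J then kap else 1 - kap).
have -> : bern_weight J = (1 - kap) * W.
  by rewrite /bern_weight (bigD1 j) //= (negbTE jJ).
have -> : bern_weight (j |: J) = kap * W.
  rewrite /bern_weight (bigD1 j) //= finset.setU11; congr (_ * _).
  by apply: eq_bigr => i ij; rewrite in_setU1 (negbTE ij).
by ring.
Qed.

Hypothesis kap01 : 0 <= kap <= 1.

Lemma bern_weight_ge0 J : 0 <= bern_weight J.
Proof.
by apply: prodr_ge0 => i _; case: ifP; rewrite ?subr_ge0; case/andP: kap01.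
Qed.

Lemma bern_mean_le F G :
  (forall J, F J <= G J) -> bern_mean F <= bern_mean G.
Proof.
by move=> FG; apply: ler_sum => J _; rewrite ler_wpM2l ?bern_weight_ge0.
Qed.

End BernoulliMean.

(** * Trace inequalities and even moments *)

(** The graph lies below its chord from [0] to [l.+1]; descending from [n], this
    keeps the bound [e 0 + e n]. *)
Lemma convex_seq_le (R : realFieldType) (n : nat) (e : nat -> R) :
  (forall l, 0 <= e l) ->
  (forall l, (l.+2 <= n)%N -> 2 * e l.+1 <= e l + e l.+2) ->
  forall l, (l <= n)%N -> e l <= e 0%N + e n.
Proof.
move=> e_ge0 e_conv.
have chord l : (l < n)%N -> l.+1%:R * e l <= e 0%N + l%:R * e l.+1.
  elim: l => [|l IHl] ln; first by rewrite mul0r mul1r addr0.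
  have := IHl (ltnW ln); have := e_conv l ln.
  have -> : l.+2%:R = l%:R + 2 :> R by rewrite -addn2 natrD.
  have -> : l.+1%:R = l%:R + 1 :> R by rewrite -addn1 natrD.
  move=> h1 h2; have l1 : 0 <= l%:R + 1 :> R by rewrite ler_wpDl // ler0n.
  have := ler_wpM2l l1 h1; lra.
move=> l ln; rewrite -(subKn ln); elim: (n - l)%N (leq_subr l n) => [|k IHk] kn.
  by rewrite subn0; have := e_ge0 0%N; lra.
set i := (n - k.+1)%N.
have iS : i.+1 = (n - k)%N by rewrite /i subnSK.
have := chord i; rewrite iS leq_subr -iS => /(_ isT).
have := IHk (ltnW kn); rewrite -iS.
have -> : i.+1%:R = i%:R + 1 :> R by rewrite -addn1 natrD.
move=> h1; have := ler_wpM2l (ler0n R i) h1.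
have := e_ge0 n; have i0 := ler0n R i; have := e_ge0 0%N => e0 en h2 h3.
have i1 : 0 < i%:R + 1 :> R by lra.
rewrite -(ler_pM2l i1); lra.
Qed.

Lemma subrXX_noncomm (A : nzRingType) (a b : A) n :
  a ^+ n.+1 - b ^+ n.+1 = \sum_(i < n.+1) a ^+ i * (a - b) * b ^+ (n - i).
Proof.
elim: n => [|n IHn]; first by rewrite big_ord1 !expr1 expr0 mul1r mulr1.
rewrite big_ord_recr /= subnn expr0 mulr1.
have -> : \sum_(i < n.+1) a ^+ i * (a - b) * b ^+ (n.+1 - i) =
          (a ^+ n.+1 - b ^+ n.+1) * b.
  rewrite IHn mulr_suml; apply: eq_bigr => i _.
  by rewrite subSn ?exprSr ?mulrA // -ltnS.
by rewrite mulrBl mulrBr -!exprSr addrC addrA subrK.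
Qed.

(** The inequalities of this part are algebraic: they hold for a positive tracial
    functional [phi] on any complex algebra with an involution [star]. *)
Section TraceInequalities.
Variables (R : realType) (A : algType R[i]).
Variables (star : {additive A -> A}) (phi : {additive A -> R}).
Hypotheses (starM : forall a b, star (a * b) = star b * star a)
           (starZ1 : forall c : R, star (c%:C%C *: 1) = c%:C%C *: 1).
Hypotheses (phiZ : forall (c : R) a, phi (c%:C%C *: a) = c * phi a)
           (phiC : forall a b, phi (a * b) = phi (b * a))
           (phi_ge0 : forall a, 0 <= phi (star a * a)).

Lemma star1 : star 1 = 1.
Proof. by have := starZ1 1; rewrite scale1r. Qed.

Lemma starX a n : star (a ^+ n) = star a ^+ n.
Proof. by elim: n => [|n IHn]; rewrite ?star1 // exprS starM IHn -exprSr. Qed.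

Lemma phi_sqr_ge0 a : star a = a -> 0 <= phi (a ^+ 2).
Proof. by move=> sa; rewrite expr2 -{1}sa. Qed.

Lemma phi_even_ge0 a n : star a = a -> 0 <= phi (a ^+ n.*2).
Proof. by move=> sa; rewrite -mul2n mulnC exprM phi_sqr_ge0 // starX sa. Qed.

Section PowerDifference.
Variables (a b d : A).
Hypotheses (sa : star a = a) (sb : star b = b) (sd : star d = d).

Let c i j := phi (d * a ^+ i * d * b ^+ j).

Let star_word p q : star (a ^+ p * d * b ^+ q) = b ^+ q * d * a ^+ p.
Proof. by rewrite !starM !starX sa sb sd mulrA. Qed.

Let phi_words p q p' q' :
  phi (star (a ^+ p * d * b ^+ q) * (a ^+ p' * d * b ^+ q')) =
  c (p + p') (q' + q).
Proof. by rewrite star_word /c !exprD -!mulrA phiC !mulrA. Qed.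

Let word_even_ge0 p q : 0 <= c p.*2 q.*2.
Proof. by rewrite -!addnn -phi_words phi_ge0. Qed.

(** Cauchy-Schwarz for the words [a^p d b^(q+h)] and [a^(p+h) d b^q]. The four
    exponents of the outer words are even, so those words have nonnegative trace,
    while the parity of the middle one is that of [h]. *)
Let word_convex p q h :
  2 * c (p + p + h) (q + q + h) <=
  c (p + p) (q + h + (q + h)) + c (p + h + (p + h)) (q + q).
Proof.
have := phi_ge0 (a ^+ p * d * b ^+ (q + h) - a ^+ (p + h) * d * b ^+ q).
rewrite raddfB mulrBl !mulrBr !raddfB /= !phi_words.
rewrite [(p + h + p)%N]addnAC [(q + h + q)%N]addnAC !addnA; lra.
Qed.

(** Words with even exponents form a convex sequence (step 2); a word with odd
    exponents is bounded by its two even neighbours (step 1). *)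
Let word_le s i : (i <= s.*2)%N -> c i (s.*2 - i) <= c 0 s.*2 + c s.*2 0.
Proof.
pose e l := c l.*2 (s - l).*2.
have e_ge0 l : 0 <= e l by exact: word_even_ge0.
have e_le l : (l <= s)%N -> e l <= c 0 s.*2 + c s.*2 0.
  move=> ls; have := @convex_seq_le R s e e_ge0 _ l ls.
  rewrite /e subn0 subnn; apply => k ks; have := word_convex k (s - k.+2) 2.
  have -> : (k + k + 2 = k.+1.*2)%N by lia.
  have -> : (s - k.+2 + (s - k.+2) + 2 = (s - k.+1).*2)%N by lia.
  have -> : (k + k = k.*2)%N by lia.
  have -> : (s - k.+2 + 2 + (s - k.+2 + 2) = (s - k).*2)%N by lia.
  have -> : (k + 2 + (k + 2) = k.+2.*2)%N by lia.
  by have -> : (s - k.+2 + (s - k.+2) = (s - k.+2).*2)%N by lia.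
move=> is_; case: (boolP (odd i)) => oi; last first.
  have -> : i = i./2.*2 by rewrite -[LHS]odd_double_half (negbTE oi).
  by rewrite -doubleB; apply: e_le; lia.
have iE : i = i./2.*2.+1 by rewrite -[LHS]odd_double_half oi.
have := e_le i./2; have := e_le i./2.+1.
have := word_convex i./2 (s - i./2.+1) 1.
have -> : (i./2 + i./2 + 1 = i)%N by lia.
have -> : (s - i./2.+1 + (s - i./2.+1) + 1 = s.*2 - i)%N by lia.
have -> : (i./2 + i./2 = i./2.*2)%N by lia.
have -> : (s - i./2.+1 + 1 + (s - i./2.+1 + 1) = (s - i./2).*2)%N by lia.
have -> : (i./2 + 1 + (i./2 + 1) = i./2.+1.*2)%N by lia.
have -> : (s - i./2.+1 + (s - i./2.+1) = (s - i./2.+1).*2)%N by lia.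
rewrite -/(e i./2) -/(e i./2.+1) => h1 h2 h3.
have {}h2 := h2 ltac:(lia); have {}h3 := h3 ltac:(lia); lra.
Qed.

(** A mean value inequality under the trace: the telescoping sum of
    [a ^+ n - b ^+ n] consists of words, each below the two extreme ones. *)
Lemma trace_power_difference s : d = a - b ->
  phi (d * (a ^+ s.*2.+1 - b ^+ s.*2.+1)) <=
  s.*2.+1%:R * (phi (d ^+ 2 * a ^+ s.*2) + phi (d ^+ 2 * b ^+ s.*2)).
Proof.
move=> dE; rewrite subrXX_noncomm -dE mulr_sumr raddf_sum /=.
apply: (@le_trans _ _ (\sum_(i < s.*2.+1) (c 0 s.*2 + c s.*2 0))).
  by apply: ler_sum => i _; rewrite !mulrA; apply: word_le; rewrite -ltnS.
rewrite sumr_const card_ord /c !expr0 !mulr1 (phiC _ d) !mulrA -expr2.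
by rewrite -[X in X <= _]mulr_natl [X in _ * X <= _]addrC.
Qed.

End PowerDifference.

Section SampleMoments.
Variables (m : nat) (x : 'I_m -> A) (r kap k : R).
Hypotheses (r_ge0 : 0 <= r) (k_ge0 : 0 <= k) (kap01 : 0 <= kap <= 1).
Hypotheses (sx : forall j, star (x j) = x j)
  (x_ge0 : forall j y, 0 <= phi (star y * x j * y))
  (x_sqr_le : forall j y,
     phi (star y * x j ^+ 2 * y) <= r * phi (star y * x j * y))
  (sum_x : \sum_j kap%:C%C *: x j = k%:C%C *: 1).

Definition centered_sample (J : {set 'I_m}) : A :=
  \sum_j ((j \in J)%:R - kap)%:C%C *: x j.
Local Notation Y := centered_sample.

Definition sample_moment n : R := bern_mean kap (fun J => phi (Y J ^+ n)).
Local Notation M := sample_moment.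

Let starZ (c : R) a : star (c%:C%C *: a) = c%:C%C *: star a.
Proof. by rewrite -{1}[a]mul1r scalerAl starM starZ1 -scalerAr mulr1. Qed.

Let sY J : star (Y J) = Y J.
Proof. by rewrite raddf_sum; apply: eq_bigr => j _; rewrite starZ sx. Qed.

Let phi_sandwich a J q :
  phi (star (Y J ^+ q) * a * Y J ^+ q) = phi (a * Y J ^+ q.*2).
Proof. by rewrite starX sY -mulrA phiC -mulrA -exprD addnn. Qed.

Let Y_setU1 j J : Y (j |: J) = Y (J :\ j) + x j.
Proof.
rewrite /Y (bigD1 j) //= [in RHS](bigD1 j) //=.
rewrite finset.setU11 finset.setD11 addrAC.
rewrite (eq_bigr (fun i => ((i \in J :\ j)%:R - kap)%:C%C *: x i)); last first.
  by move=> i ij; rewrite in_setU1 in_setD1 (negbTE ij).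
congr (_ + _); rewrite -[X in _ = _ + X]scale1r -(rmorph1 (real_complex R)).
by rewrite -scalerDl -rmorphD /= mulr0n add0r addrC.
Qed.

(** Averaging over the [j]-th selector turns the centered factor into a
    difference of powers of two operators which differ by [x j]; resampling
    backwards then restores the average over [J], with weights at most
    [1_(j in J) + kap]. *)
Let moment_step_at j q :
  bern_mean kap (fun J => ((j \in J)%:R - kap) * phi (x j * Y J ^+ q.*2.+1)) <=
  q.*2.+1%:R * r *
    bern_mean kap (fun J => ((j \in J)%:R + kap) * phi (x j * Y J ^+ q.*2)).
Proof.
have G_ge0 J : 0 <= phi (x j * Y J ^+ q.*2) by rewrite -phi_sandwich x_ge0.
have [kap0 kap1] := andP kap01.
have nr_ge0 : 0 <= q.*2.+1%:R * r by rewrite mulr_ge0.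
pose v (J : {set 'I_m}) : R := if j \in J then 1 - kap else kap.
apply: (@le_trans _ _ (q.*2.+1%:R * r *
    bern_mean kap (fun J => v J * phi (x j * Y J ^+ q.*2)))); last first.
  rewrite ler_wpM2l // bern_mean_le // => J; rewrite ler_wpM2r // /v.
  by case: (j \in J) => /=; lra.
rewrite (bern_mean_resample _ j) [in leRHS](bern_mean_resample _ j) -bern_meanZ.
apply: bern_mean_le => // J; rewrite /v !finset.setU11 !finset.setD11.
set Jp := j |: J; set Jm := J :\ j.
have := trace_power_difference (sY Jp) (sY Jm) (sx j) q.
rewrite Y_setU1 addrC addKr => /(_ erefl); rewrite -Y_setU1 mulrBr raddfB /=.
have := x_sqr_le j (Y Jp ^+ q); have := x_sqr_le j (Y Jm ^+ q).
rewrite !phi_sandwich => hm hp hd.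
have n0 : 0 <= q.*2.+1%:R :> R by [].
have := ler_wpM2l n0 (lerD hp hm) => hs.
have c0 : 0 <= kap * (1 - kap) by rewrite mulr_ge0 // subr_ge0.
have := ler_wpM2l c0 (le_trans hd hs).
set n : R := q.*2.+1%:R; rewrite !mulr1n !mulr0n; lra.
Qed.

(** The weights [1_(j in J) + kap] recombine: the sum of these multiples of the
    [x j] is the centered sample plus [2 * k]. *)
Let moment_step q :
  M q.*2.+2 <= q.*2.+1%:R * r * (M q.*2.+1 + 2 * k * M q.*2).
Proof.
have phiY a J : phi (Y J * a) = \sum_j ((j \in J)%:R - kap) * phi (x j * a).
  rewrite /Y mulr_suml raddf_sum; apply: eq_bigr => j _ /=.
  by rewrite -scalerAl phiZ.
have -> : M q.*2.+1 + 2 * k * M q.*2 = \sum_j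
    bern_mean kap (fun J => ((j \in J)%:R + kap) * phi (x j * Y J ^+ q.*2)).
  rewrite -bern_meanZ -bern_meanD -bern_mean_sum; apply: eq_bigr => J _.
  congr (_ * _); rewrite exprS phiY -phiZ -[X in _ *: X]mul1r scalerAl.
  rewrite [_%:C%C]rmorphM -scalerA -sum_x scaler_sumr mulr_suml raddf_sum.
  rewrite -big_split.
  apply: eq_bigr => j _ /=; rewrite scalerA -rmorphM -scalerAl phiZ; ring.
rewrite mulr_sumr /M.
have -> : (fun J => phi (Y J ^+ q.*2.+2)) =
    (fun J => \sum_j ((j \in J)%:R - kap) * phi (x j * Y J ^+ q.*2.+1)).
  by apply/funext => J; rewrite exprS phiY.
by rewrite bern_mean_sum; apply: ler_sum => j _; exact: moment_step_at.
Qed.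

Let moment_even_ge0 q : 0 <= M q.*2.
Proof.
rewrite -(bern_mean_cst 'I_m kap 0); apply: bern_mean_le => // J.
exact: phi_even_ge0.
Qed.

(** Positivity of [Y ^+ q * (Y - c) ^+ 2 * Y ^+ q], for [c] the factor of the
    previous inequality, trades the odd moment for half of the left-hand side. *)
Lemma moment_recursion q (n : R) : q.*2.+1%:R <= n ->
  M q.*2.+2 <= ((n * r) ^+ 2 + 4 * k * (n * r)) * M q.*2.
Proof.
move=> qn; set c := q.*2.+1%:R * r.
have c0 : 0 <= c by rewrite mulr_ge0.
have amgm : 2 * c * M q.*2.+1 <= M q.*2.+2 + c ^+ 2 * M q.*2.
  rewrite /M -(bern_meanZ kap (2 * c)) -(bern_meanZ kap (c ^+ 2)) -bern_meanD.
  apply: bern_mean_le => // J.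
  have h := phi_ge0 ((Y J - c%:C%C *: 1) * Y J ^+ q).
  rewrite starM raddfB /= starZ1 sY mulrA -[_ * (Y J - _) * (Y J - _)]mulrA in h.
  rewrite phi_sandwich mulrBl !mulrBr -!(scalerAr, scalerAl) in h.
  rewrite !(mulr1, mul1r) !mulrBl -!scalerAl -mulrA -!exprS in h.
  rewrite mul1r scalerA -rmorphM !raddfB /= !phiZ in h; lra.
have := moment_step q; rewrite -/c => h.
have cn : c <= n * r by rewrite ler_wpM2r.
have d0 : 0 <= ((n * r) ^+ 2 - c ^+ 2 + 4 * k * (n * r - c)) * M q.*2.
  rewrite mulr_ge0 ?moment_even_ge0 // addr_ge0 //.
    by rewrite subr_ge0 lerXn2r // nnegrE ?(le_trans c0).
  by rewrite !mulr_ge0 // subr_ge0.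
lra.
Qed.

Lemma sample_moment_le q (n : R) : q.*2%:R <= n + 1 ->
  M q.*2 <= ((n * r) ^+ 2 + 4 * k * (n * r)) ^+ q * phi 1.
Proof.
elim: q => [|q IHq] qn.
  by rewrite expr0 mul1r /M /= -[leRHS](bern_mean_cst 'I_m kap).
have {qn}: q.*2.+1%:R <= n.
  by move: qn; rewrite doubleS -[_.+2]addn1 natrD lerD2r.
move=> qn; have n0 : 0 <= n by rewrite (le_trans _ qn).
apply: le_trans (moment_recursion qn) _; rewrite [_ ^+ q.+1]exprS -[leRHS]mulrA.
apply: ler_wpM2l; first by rewrite addr_ge0 ?sqr_ge0 // !mulr_ge0.
by apply: IHq; rewrite ler_wpDr // (le_trans _ qn) // ler_nat.
Qed.

End SampleMoments.
End TraceInequalities.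

(** * Algebras of operators *)

Section OperatorAlgebra.
Variables (K : comNzRingType) (H : lmodType K).

(** Two such families occur: all bounded operators, where spectral arguments take
    place, and the elements of a von Neumann algebra that possess an adjoint,
    where the trace inequalities apply. *)
Record operator_algebra (N : set (H -> H)) : Prop := {
  oa_linear : forall x, N x -> linear x ;
  oa_unit : N idfun ;
  oa_lin : forall (c : K) x y, N x -> N y -> N (c *: x + y) ;
  oa_mul : forall x y, N x -> N y -> N (x \o y) ;
  oa_nontrivial : (idfun : H -> H) <> 0 }.

Record operator_in (N : set (H -> H)) := OperatorIn {
  op :> H -> H ;
  op_in : N op }.

(** The closure properties are a parameter of the carrier so that the ring
    structures below can be inferred from the type. *)
Definition algebra_of (N : set (H -> H)) (hN : operator_algebra N) :=
  operator_in N.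

Variables (N : set (H -> H)) (hN : operator_algebra N).
Local Notation A := (algebra_of hN).

HB.instance Definition _ := gen_eqMixin A.
HB.instance Definition _ := gen_choiceMixin A.

Lemma op_inj (a b : A) : op a =1 op b -> a = b.
Proof.
case: a b => [x Nx] [y Ny] /= /funext xy.
by move: Ny; rewrite -xy => Ny; congr OperatorIn; exact: Prop_irrelevance.
Qed.

Lemma oa_add x y : N x -> N y -> N (x + y).
Proof. by move=> Nx Ny; have := oa_lin hN 1 Nx Ny; rewrite scale1r. Qed.

Lemma oa_zero : N 0.
Proof.
by have := oa_lin hN (-1) (oa_unit hN) (oa_unit hN); rewrite scaleN1r addNr.
Qed.

Lemma oa_scale (c : K) x : N x -> N (c *: x).
Proof. by move=> Nx; have := oa_lin hN c Nx oa_zero; rewrite addr0. Qed.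

Lemma oa_opp x : N x -> N (- x).
Proof. by rewrite -scaleN1r; exact: oa_scale. Qed.

Definition op0 : A := OperatorIn oa_zero.
Definition op1 : A := OperatorIn (oa_unit hN).
Definition opD (a b : A) : A := OperatorIn (oa_add (op_in a) (op_in b)).
Definition opN (a : A) : A := OperatorIn (oa_opp (op_in a)).
Definition opM (a b : A) : A := OperatorIn (oa_mul hN (op_in a) (op_in b)).
Definition opZ (c : K) (a : A) : A := OperatorIn (oa_scale c (op_in a)).

HB.instance Definition _ (a : A) :=
  GRing.isLinear.Build K H H *:%R (op a) (oa_linear hN (op_in a)).

Fact opDA : associative opD.
Proof. by move=> a b c; apply: op_inj => v; exact: addrA. Qed.
Fact opDC : commutative opD.
Proof. by move=> a b; apply: op_inj => v; exact: addrC. Qed.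
Fact op0D : left_id op0 opD.
Proof. by move=> a; apply: op_inj => v; exact: add0r. Qed.
Fact opND : left_inverse op0 opN opD.
Proof. by move=> a; apply: op_inj => v; exact: addNr. Qed.

HB.instance Definition _ := GRing.isZmodule.Build A opDA opDC op0D opND.

Fact opMA : associative opM.
Proof. by move=> a b c; apply: op_inj. Qed.
Fact op1M : left_id op1 opM.
Proof. by move=> a; apply: op_inj. Qed.
Fact opM1 : right_id op1 opM.
Proof. by move=> a; apply: op_inj. Qed.
Fact opMDl : left_distributive opM opD.
Proof. by move=> a b c; apply: op_inj. Qed.
Fact opMDr : right_distributive opM opD.
Proof. by move=> a b c; apply: op_inj => v; exact: (raddfD a). Qed.
Fact op1_neq0 : op1 != op0.
Proof. by apply/eqP => /(congr1 (@op N)); exact: (oa_nontrivial hN). Qed.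

HB.instance Definition _ :=
  GRing.Zmodule_isNzRing.Build A opMA op1M opM1 opMDl opMDr op1_neq0.

Fact opZA c d (a : A) : opZ c (opZ d a) = opZ (c * d) a.
Proof. by apply: op_inj => v; exact: scalerA. Qed.
Fact op1Z : left_id 1 opZ.
Proof. by move=> a; apply: op_inj => v; exact: scale1r. Qed.
Fact opZDr : right_distributive opZ +%R.
Proof. by move=> c a b; apply: op_inj => v; exact: scalerDr. Qed.
Fact opZDl (a : A) : {morph opZ^~ a : c d / c + d}.
Proof. by move=> c d; apply: op_inj => v; exact: scalerDl. Qed.

HB.instance Definition _ :=
  GRing.Zmodule_isLmodule.Build K A opZA op1Z opZDr opZDl.

Fact opZMl (c : K) (a b : A) : c *: (a * b) = (c *: a) * b.
Proof. by apply: op_inj. Qed.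

HB.instance Definition _ := GRing.Lmodule_isLalgebra.Build K A opZMl.

Fact opZMr (c : K) (a b : A) : c *: (a * b) = a * (c *: b).
Proof. by apply: op_inj => v; rewrite [RHS]/= linearZ. Qed.

HB.instance Definition _ := GRing.Lalgebra_isAlgebra.Build K A opZMr.

Lemma opDE (a b : A) v : (a + b) v = a v + b v. Proof. by []. Qed.
Lemma opNE (a : A) v : (- a) v = - a v. Proof. by []. Qed.
Lemma opBE (a b : A) v : (a - b) v = a v - b v. Proof. by []. Qed.
Lemma opME (a b : A) v : (a * b) v = a (b v). Proof. by []. Qed.
Lemma opZE (c : K) (a : A) v : (c *: a) v = c *: a v. Proof. by []. Qed.
Lemma op1E v : (1 : A) v = v. Proof. by []. Qed.
Lemma op0E v : (0 : A) v = 0. Proof. by []. Qed.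

Lemma opXE (a : A) n v : (a ^+ n) v = iter n a v.
Proof. by elim: n => [|n IHn] //; rewrite exprS opME IHn. Qed.

Lemma op_sumE (I : Type) (s : seq I) (P : pred I) (F : I -> A) v :
  (\sum_(i <- s | P i) F i) v = \sum_(i <- s | P i) F i v.
Proof. by elim/big_rec2: _ => // i y1 y2 _ <-. Qed.

End OperatorAlgebra.

(* Otherwise simplification turns ring expressions into bare functions. *)
Arguments op : simpl never.

(** * Operators on a Hilbert space *)

Section HilbertNorm.
Variables (R : realType) (H : completeNormedModType R[i]).
Variable ip : {dot H for (@Num.conj R[i])}.
Hypothesis ip_norm : forall v : H, ip v v = `|v| ^+ 2.
Implicit Types (u v w : H) (x y : H -> H).

Definition nrm v : R := complex.Re `|v|.

Lemma nrmE v : `|v| = (nrm v)%:C%C.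
Proof. by rewrite RRe_real // ger0_real. Qed.

Lemma nrm_ge0 v : 0 <= nrm v.
Proof. by have := normr_ge0 v; rewrite nrmE ler0c. Qed.

Lemma nrm0 : nrm 0 = 0.
Proof. by rewrite /nrm normr0. Qed.

Lemma nrm0_eq0 v : nrm v = 0 -> v = 0.
Proof. by move=> v0; apply/eqP; rewrite -normr_eq0 nrmE v0. Qed.

Lemma nrmN v : nrm (- v) = nrm v.
Proof. by rewrite /nrm normrN. Qed.

Lemma nrmD u v : nrm (u + v) <= nrm u + nrm v.
Proof. by have := ler_normD u v; rewrite !nrmE -rmorphD lecR. Qed.

Lemma nrmB u v : nrm (u - v) <= nrm u + nrm v.
Proof. by rewrite -[nrm v]nrmN nrmD. Qed.

Lemma nrmZ (c : R[i]) v : nrm (c *: v) = complex.Re `|c| * nrm v.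
Proof.
rewrite /nrm normrZ !nrmE -[`|c|]RRe_real ?ger0_real //.
by rewrite -rmorphM.
Qed.

Lemma normc_real (c : R) : complex.Re `|c%:C%C| = `|c|.
Proof. by rewrite normc_def /= expr0n addr0 sqrtr_sqr. Qed.

Lemma nrmZr (c : R) v : nrm (c%:C%C *: v) = `|c| * nrm v.
Proof. by rewrite nrmZ normc_real. Qed.

Lemma ip_nrm v : ip v v = (nrm v ^+ 2)%:C%C.
Proof. by rewrite ip_norm nrmE -rmorphXn. Qed.

Lemma Re_ip_nrm v : complex.Re (ip v v) = nrm v ^+ 2.
Proof. by rewrite ip_nrm. Qed.

Lemma ipDl u v w : ip (u + v) w = ip u w + ip v w.
Proof. by rewrite linearDl. Qed.
Lemma ipBl u v w : ip (u - v) w = ip u w - ip v w.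
Proof. by rewrite linearBl. Qed.
Lemma ipZl c u w : ip (c *: u) w = c * ip u w.
Proof. by rewrite linearZl_LR. Qed.
Lemma ipDr u v w : ip w (u + v) = ip w u + ip w v.
Proof. by rewrite linearDr. Qed.
Lemma ipBr u v w : ip w (u - v) = ip w u - ip w v.
Proof. by rewrite linearBr. Qed.
Lemma ip0l u : ip 0 u = 0. Proof. by rewrite linear0l. Qed.
Lemma ip0r u : ip u 0 = 0. Proof. by rewrite linear0r. Qed.
Lemma ipC u v : ip v u = (ip u v)^*%C.
Proof. by rewrite hermC /= expr0 mul1r. Qed.
Lemma ipZr c u w : ip w (c *: u) = c^*%C * ip w u.
Proof. by rewrite linearZr_LR. Qed.


Lemma Re_conjc (z : R[i]) : complex.Re z^*%C = complex.Re z.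
Proof. by case: z. Qed.

Lemma nrm_subr_sqr u v :
  nrm (u - v) ^+ 2 = nrm u ^+ 2 - 2 * complex.Re (ip u v) + nrm v ^+ 2.
Proof.
rewrite -!Re_ip_nrm ipBl !ipBr (ipC u v) !raddfB /= Re_conjc; ring.
Qed.

Lemma Re_ip_le u v : complex.Re (ip u v) <= nrm u * nrm v.
Proof.
have [u0|u0] := eqVneq (nrm u) 0.
  by rewrite (nrm0_eq0 u0) ip0l nrm0 mul0r.
have [v0|v0] := eqVneq (nrm v) 0.
  by rewrite (nrm0_eq0 v0) ip0r nrm0 mulr0.
have up : 0 < nrm u by rewrite lt_neqAle eq_sym u0 nrm_ge0.
have vp : 0 < nrm v by rewrite lt_neqAle eq_sym v0 nrm_ge0.
have := sqr_ge0 (nrm ((nrm v)%:C%C *: u - (nrm u)%:C%C *: v)).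
rewrite nrm_subr_sqr !nrmZr !ger0_norm ?nrm_ge0 // ipZl ipZr conjc_real.
rewrite mulrA -rmorphM; move: (ip u v) => [p q] /=; rewrite mul0r subr0.
move=> h; rewrite -(ler_pM2l (mulr_gt0 vp up)); lra.
Qed.

Lemma normr_Re_ip_le u v : `|complex.Re (ip u v)| <= nrm u * nrm v.
Proof.
rewrite ler_norml Re_ip_le andbT lerNl -raddfN /= -[- ip u v]mulN1r -ipZl.
by rewrite scaleN1r (le_trans (Re_ip_le _ _)) // nrmN.
Qed.

Lemma normr_Im_ip_le u v : `|complex.Im (ip u v)| <= nrm u * nrm v.
Proof.
have -> : complex.Im (ip u v) = complex.Re (ip u ('i%C *: v)).
  by rewrite ipZr; case: (ip u v) => p q /=; ring.
apply: le_trans (normr_Re_ip_le _ _) _.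
by rewrite nrmZ normc_def /= expr0n expr1n add0r sqrtr1 mul1r.
Qed.

(** The quadratic form of [x], that is, its numerical range up to scaling. *)
Definition num x v : R := complex.Re (ip (x v) v).
Definition symm x := forall u v, ip (x u) v = ip u (x v).

Lemma positive_opP x : positive_op ip x <->
  forall v, complex.Im (ip (x v) v) = 0 /\ 0 <= num x v.
Proof.
split=> h v; have := h v; first by rewrite lecE => /andP[/eqP].
by rewrite lecE => -[-> ->]; rewrite eqxx.
Qed.

Lemma symm_real x v : symm x -> complex.Im (ip (x v) v) = 0.
Proof.
move=> sx; have := ipC (x v) v; rewrite -sx.
by case: (ip (x v) v) => p q [] /= h; lra.
Qed.

Lemma symm_positive x : symm x -> (forall v, 0 <= num x v) -> positive_op ip x.
Proof. by move=> sx x0; apply/positive_opP => v; split; rewrite ?symm_real. Qed.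

(** Polarization: the defect [f] of symmetry is sesquilinear and vanishes on the
    diagonal, hence it is antisymmetric; replacing [v] by [i v] gives [f = 0]. *)
Lemma positive_symm (x : {linear H -> H}) : positive_op ip x -> symm x.
Proof.
move=> /positive_opP x0; pose f u v := ip (x u) v - ip u (x v).
have f0 w : f w w = 0.
  have [im0 _] := x0 w; rewrite /f (ipC (x w) w).
  by case: (ip (x w) w) im0 => p q /= ->; rewrite oppr0 subrr.
have fD u v : f u v = - f v u.
  have : f (u + v) (u + v) = f u u + f v v + (f u v + f v u).
    by rewrite /f [x (u + v)]raddfD !ipDl !ipDr; ring.
  by rewrite !f0 !add0r => /esym/eqP; rewrite addr_eq0 => /eqP.
move=> u v; apply/eqP; rewrite -subr_eq0 -/(f u v).
have fi : f u ('i%C *: v) = - 'i%C * f u v.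
  rewrite /f [x ('i%C *: v)]linearZ !ipZr /=.
  case: (ip _ _) => p q; case: (ip _ _) => p' q'.
  by congr (_ +i* _)%C; ring.
have fi' : f ('i%C *: v) u = 'i%C * f v u.
  by rewrite /f [x ('i%C *: v)]linearZ !ipZl /= mulrBr.
have := fD u ('i%C *: v); rewrite fi fi' (fD v u) mulrN opprK.
case: (f u v) => p q [] /= h1 h2; rewrite eq_complex /=.
by apply/andP; split; apply/eqP; lra.
Qed.

(** This is [x ^+ 2 <= M x] for [0 <= x <= M], obtained by evaluating the
    quadratic form at [v - M^-1 x v]. *)
Lemma positive_sqr_le (x : {linear H -> H}) M : 0 < M -> symm x ->
  (forall v, 0 <= num x v) -> (forall v, num x v <= M * nrm v ^+ 2) ->
  forall v, nrm (x v) ^+ 2 <= M * num x v.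
Proof.
move=> M0 sx x0 xM v; have := x0 (v - M^-1%:C%C *: x v).
rewrite /num [x (v - _)]linearB [x (_ *: _)]linearZ /=.
rewrite ipBl !ipBr !ipZl !ipZr conjc_real sx.
rewrite !raddfB /= ip_nrm => h; have := xM (x v); rewrite /num => h2.
move: h; rewrite mulrA -rmorphM.
case: (ip (x v) v) (ip (x (x v)) (x v)) h2 => p q [p' q'] /=.
rewrite ?(mul0r, mulr0, subr0) => h2 h.
have M1 : 0 < M^-1 by rewrite invr_gt0.
have h3 := ler_wpM2l (ltW (mulr_gt0 M1 M1)) h2.
have e : M^-1 * M^-1 * (M * nrm (x v) ^+ 2) = M^-1 * nrm (x v) ^+ 2.
  by field; rewrite gt_eqF.
have : M^-1 * nrm (x v) ^+ 2 <= p by lra.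
by rewrite ler_pdivrMl.
Qed.

End HilbertNorm.

(** * Polynomials in a positive operator *)

Section PolynomialEvaluation.
Variables (R : realType) (A : algType R[i]).

Definition peval (a : A) (q : {poly R}) : A :=
  horner_alg a (map_poly (real_complex R) q).

HB.instance Definition _ (a : A) :=
  GRing.RMorphism.copy (peval a)
    (horner_alg a \o map_poly (real_complex R)).

Lemma pevalC a c : peval a c%:P = c%:C%C *: 1.
Proof. by rewrite /peval map_polyC horner_algC. Qed.

Lemma pevalX a : peval a 'X = a.
Proof. by rewrite /peval map_polyX horner_algX. Qed.

Lemma pevalZ a c q : peval a (c *: q) = c%:C%C *: peval a q.
Proof. by rewrite -mul_polyC rmorphM /= pevalC -scalerAl mul1r. Qed.

Lemma peval_sum a q : peval a q = \sum_(i < size q) (q`_i)%:C%C *: a ^+ i.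
Proof.
rewrite -[in LHS](coefK q) poly_def rmorph_sum /=; apply: eq_bigr => i _.
by rewrite pevalZ rmorphXn /= pevalX.
Qed.

Lemma peval_comp_sqr a q : peval a (q \Po 'X^2) = peval (a ^+ 2) q.
Proof.
elim/poly_ind: q => [|q c IHq]; first by rewrite comp_poly0 !rmorph0.
rewrite comp_poly_MXaddC !rmorphD !rmorphM /= !pevalC IHq !pevalX.
by rewrite expr2.
Qed.

Lemma peval_comm a b q : GRing.comm b a -> GRing.comm b (peval a q).
Proof.
move=> ab; elim/poly_ind: q => [|q c IHq].
  by rewrite rmorph0; exact: commr0.
rewrite rmorphD rmorphM /= pevalX pevalC; apply: commrD; first exact: commrM.
by rewrite /GRing.comm -scalerAr -scalerAl mulr1 mul1r.
Qed.

End PolynomialEvaluation.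

Section PositiveFunctionalCalculus.
Variables (R : realType) (H : completeNormedModType R[i]).
Variable ip : {dot H for (@Num.conj R[i])}.
Hypothesis ip_norm : forall v : H, ip v v = `|v| ^+ 2.
Hypothesis H_nontrivial : (idfun : H -> H) <> 0.
Implicit Types (u v w : H) (x y : H -> H).

Lemma bounded_opP x : bounded_op x <->
  linear x /\ exists2 M : R, 0 < M & forall v, nrm (x v) <= M * nrm v.
Proof.
split=> -[lx [M]]; last first.
  move=> M0 xM; split=> //; exists M => v.
  by rewrite !nrmE -rmorphM lecR xM.
move=> xM; split=> //; exists (Num.max M 1); first by rewrite lt_max ltr01 orbT.
move=> v; have := xM v; rewrite !nrmE -rmorphM lecR => /le_trans; apply.
by rewrite ler_wpM2r ?nrm_ge0 // le_max lexx.
Qed.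

Lemma bounded_op_algebra : operator_algebra (@bounded_op R H).
Proof.
split=> //.
- by move=> x [].
- apply/bounded_opP; split=> //; exists 1 => // v; by rewrite mul1r.
- move=> c x y /bounded_opP[lx [M M0 xM]] /bounded_opP[ly [M' M'0 yM]].
  apply/bounded_opP; split.
    move=> b u v; rewrite !fctE lx ly !scalerDr !scalerA [c * b]mulrC.
    exact: addrACA.
  exists (complex.Re `|c| * M + M').
    rewrite ltr_wpDl // mulr_ge0 //; last exact: ltW.
    by have := normr_ge0 c; rewrite lecE => /andP[].
  move=> v; apply: le_trans (nrmD _ _) _; rewrite nrmZ mulrDl -mulrA lerD //.
  by rewrite ler_wpM2l //; have := normr_ge0 c; rewrite lecE => /andP[].
- move=> x y /bounded_opP[lx [M M0 xM]] /bounded_opP[ly [M' M'0 yM]].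
  apply/bounded_opP; split; first by move=> b u v /=; rewrite ly lx.
  exists (M * M') => [|v /=]; first exact: mulr_gt0.
  by apply: le_trans (xM _) _; rewrite -mulrA ler_wpM2l // ltW.
Qed.

Local Notation B := (algebra_of bounded_op_algebra).
Implicit Types (a b : B).

Lemma op_bound a : exists2 M : R, 0 < M & forall v, nrm (a v) <= M * nrm v.
Proof. by have /bounded_opP[] := op_in a. Qed.

Lemma numD a b v : num ip (a + b) v = num ip a v + num ip b v.
Proof. by rewrite /num opDE ipDl raddfD. Qed.

Lemma num_scalar (c : R) v : num ip (c%:C%C *: 1 : B) v = c * nrm v ^+ 2.
Proof. by rewrite /num opZE op1E ipZl ip_nrm // -rmorphM. Qed.

Lemma numN a v : num ip (- a) v = - num ip a v.
Proof. by rewrite /num opNE -[X in ip X]scaleN1r ipZl mulN1r raddfN. Qed.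

Lemma numB a b v : num ip (a - b) v = num ip a v - num ip b v.
Proof. by rewrite numD numN. Qed.

Lemma num_le (x : H -> H) (M : R) v : nrm (x v) <= M * nrm v ->
  `|num ip x v| <= M * nrm v ^+ 2.
Proof.
move=> xM; apply: le_trans (normr_Re_ip_le ip_norm _ _) _.
by rewrite expr2 mulrA ler_wpM2r // nrm_ge0.
Qed.

Lemma symmD a b : symm ip a -> symm ip b -> symm ip (a + b).
Proof. by move=> sa sb u v; rewrite !opDE ipDl ipDr sa sb. Qed.

Lemma symm_scale (c : R) a : symm ip a -> symm ip (c%:C%C *: a).
Proof. by move=> sa u v; rewrite !opZE ipZl ipZr conjc_real sa. Qed.

Lemma symm_peval a q : symm ip a -> symm ip (peval a q).
Proof.
move=> sa; elim/poly_ind: q => [|q c IHq].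
  by rewrite rmorph0 => u v; rewrite !op0E ip0l ip0r.
rewrite rmorphD rmorphM /= pevalX pevalC. apply: symmD; last exact: symm_scale.
move=> u v; rewrite opME IHq sa.
have := commr_refl a; move/(peval_comm q) => /(congr1 (fun b : B => b v)).
by rewrite !opME => ->.
Qed.

Definition bounded_below x :=
  exists2 c : R, 0 < c & forall v, c * nrm v <= nrm (x v).

Lemma bounded_below_comp x y :
  bounded_below x -> bounded_below y -> bounded_below (x \o y).
Proof.
move=> [c c0 xc] [d d0 yd]; exists (c * d) => [|v]; first exact: mulr_gt0.
by apply: le_trans (xc _); rewrite -mulrA ler_wpM2l // ltW.
Qed.

(** The numerical range of [a - z] avoids a neighbourhood of [0]: through its
    imaginary part when [z] is not real, otherwise through its real part. *)
Lemma shift_bounded_below a (M : R) (z : R[i]) :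
  symm ip a -> (forall v, 0 <= num ip a v <= M * nrm v ^+ 2) ->
  ~ (complex.Im z = 0 /\ 0 <= complex.Re z <= M) -> bounded_below (a - z *: 1).
Proof.
move=> sa aM zM.
(* By Cauchy-Schwarz, a lower bound of the quadratic form is one of the norm. *)
have via_num (c : R) (f : H -> R) : 0 < c ->
    (forall v, f v <= nrm ((a - z *: 1) v) * nrm v) ->
    (forall v, c * nrm v ^+ 2 <= f v) -> bounded_below (a - z *: 1).
  move=> c0 fle cf; exists c => // v.
  have [v0|v0] := eqVneq (nrm v) 0; first by rewrite v0 mulr0 nrm_ge0.
  have vp : 0 < nrm v by rewrite lt_neqAle eq_sym v0 nrm_ge0.
  by rewrite -(ler_pM2r vp) -mulrA -expr2; exact: le_trans (cf v) (fle v).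
have ipE v : ip ((a - z *: 1) v) v = ip (a v) v - z * (nrm v ^+ 2)%:C%C.
  by rewrite opBE opZE op1E ipBl ipZl ip_nrm.
have Imz v : complex.Im (ip ((a - z *: 1) v) v) = - complex.Im z * nrm v ^+ 2.
  rewrite ipE raddfB /= symm_real // add0r.
  by case: z {zM via_num ipE} => p q /=; ring.
have Rez v : complex.Re (ip ((a - z *: 1) v) v) =
    num ip a v - complex.Re z * nrm v ^+ 2.
  rewrite ipE raddfB /=; congr (_ - _).
  by case: z {zM via_num ipE Imz} => p q /=; ring.
have [im0|im_neq0] := eqVneq (complex.Im z) 0; last first.
  apply: (via_num _ _ _ (fun v => normr_Im_ip_le ip_norm _ v)) => [|v].
    by rewrite -normr_gt0 in im_neq0; exact: im_neq0.
  by rewrite Imz normrM normrN (ger0_norm (sqr_ge0 _)).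
have [re_lt0|re_ge0] := ltP (complex.Re z) 0.
  apply: (via_num _ _ _ (fun v => Re_ip_le ip_norm _ v)) => [|v].
    by rewrite -oppr_gt0 in re_lt0; exact: re_lt0.
  by rewrite Rez; have /andP[] := aM v; lra.
have [re_leM|re_gtM] := leP (complex.Re z) M.
  by exfalso; apply: zM; rewrite re_ge0.
apply: (via_num (complex.Re z - M)
  (fun v => - complex.Re (ip ((a - z *: 1) v) v))).
- by rewrite subr_gt0.
- move=> v; rewrite (le_trans (ler_norm _)) // normrN.
  exact: normr_Re_ip_le.
- by move=> v; rewrite Rez; have /andP[] := aM v; lra.
Qed.

(** Over the complex numbers the polynomial splits into factors [a - z], each of
    them bounded below. *)
Lemma poly_bounded_below a (M : R) (p : {poly R[i]}) :
  symm ip a -> (forall v, 0 <= num ip a v <= M * nrm v ^+ 2) -> p != 0 ->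
  (forall z, root p z -> ~ (complex.Im z = 0 /\ 0 <= complex.Re z <= M)) ->
  bounded_below (horner_alg a p).
Proof.
move=> sa aM p0 pM; have [rs pE] := closed_field_poly_normal p.
have lc0 : lead_coef p != 0 by rewrite lead_coef_eq0.
have {}pM z : z \in rs -> ~ (complex.Im z = 0 /\ 0 <= complex.Re z <= M).
  by move=> zrs; apply: pM; rewrite pE rootZ // root_prod_XsubC.
rewrite pE linearZ /= rmorph_prod /=.
have : bounded_below (\prod_(z <- rs) horner_alg a ('X - z%:P)).
  elim: rs pM {pE} => [|z rs IHrs] pM.
    by rewrite big_nil; exists 1 => // v; rewrite mul1r.
  rewrite big_cons; apply: bounded_below_comp; last first.
    by apply: IHrs => t trs; apply: pM; rewrite inE trs orbT.
  rewrite raddfB /= horner_algX horner_algC.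
  by apply: shift_bounded_below aM _ => //; apply: pM; rewrite mem_head.
case=> c c0 cP; exists (complex.Re `|lead_coef p| * c).
  rewrite mulr_gt0 //; have : 0 < `|lead_coef p| by rewrite normr_gt0.
  by rewrite ltcE => /andP[].
move=> v; rewrite opZE nrmZ -mulrA ler_wpM2l //.
by have := normr_ge0 (lead_coef p); rewrite lecE => /andP[].
Qed.

End PositiveFunctionalCalculus.

Section PositivityOfPolynomials.
Variables (R : realType) (H : completeNormedModType R[i]).
Variable ip : {dot H for (@Num.conj R[i])}.
Hypothesis ip_norm : forall v : H, ip v v = `|v| ^+ 2.
Hypothesis H_nontrivial : (idfun : H -> H) <> 0.
Local Notation B := (algebra_of (bounded_op_algebra H_nontrivial)).
Implicit Types (a b : B) (u v : H).

Lemma exists_nrm_gt0 : exists v : H, 0 < nrm v.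
Proof.
apply: contrapT => /forallNP h; apply: H_nontrivial; apply/funext => v.
apply: nrm0_eq0; apply/eqP; rewrite eq_le nrm_ge0 andbT leNgt.
by apply/negP; exact: h.
Qed.

Lemma num_inf a : exists l : R,
  (forall v, l * nrm v ^+ 2 <= num ip a v) /\
  (forall c, (forall v, c * nrm v ^+ 2 <= num ip a v) -> c <= l).
Proof.
pose S := [set c : R | forall v, c * nrm v ^+ 2 <= num ip a v].
have [v0 v0_gt0] := exists_nrm_gt0; have n0 := exprn_gt0 2 v0_gt0.
have supS : has_sup S.
  split; last first.
    by exists (num ip a v0 / nrm v0 ^+ 2) => c Sc; rewrite ler_pdivlMr.
  have [M M0 aM] := op_bound a; exists (- M) => v.
  have := num_le ip_norm (aM v); rewrite ler_norml => /andP[+ _].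
  by rewrite mulNr.
exists (sup S); split=> [v|c Sc]; last exact: (sup_upper_bound supS).
have [v_eq0|v_neq0] := eqVneq (nrm v ^+ 2) 0.
  by have [c Sc] := supS.1; have := Sc v; rewrite v_eq0 !mulr0.
have vp : 0 < nrm v ^+ 2 by rewrite lt_neqAle eq_sym v_neq0 sqr_ge0.
rewrite -ler_pdivlMr //; apply: ge_sup; first exact: supS.1.
by move=> c Sc; rewrite ler_pdivlMr.
Qed.

Section Positive.
Variables (a : B) (M : R).
Hypotheses (a_ge0 : positive_op ip a)
  (aM : forall v, num ip a v <= M * nrm v ^+ 2).

Let sa : symm ip a. Proof. exact: positive_symm. Qed.

Let a0M v : 0 <= num ip a v <= M * nrm v ^+ 2.
Proof. by rewrite aM andbT; move/positive_opP: a_ge0 => /(_ v)[]. Qed.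

(** Were the lower bound [l] of the quadratic form of [q(a)] negative, [q - l]
    would be positive on [0, M] and [q(a) - l] bounded below; being positive, it
    would then dominate a positive multiple of the identity, against the choice
    of [l]. *)
Lemma num_peval_ge0 q : (forall s, 0 <= s <= M -> 0 < q.[s]) ->
  forall v, 0 <= num ip (peval a q) v.
Proof.
move=> q_gt0; have [l [l_lb l_inf]] := num_inf (peval a q).
suff l0 : 0 <= l.
  by move=> v; apply: le_trans (l_lb v); rewrite mulr_ge0 // sqr_ge0.
rewrite leNgt; apply/negP => l_lt0.
pose T := peval a (q - l%:P).
have TE : T = peval a q - l%:C%C *: 1 by rewrite /T rmorphB /= pevalC.
have T_ge0 v : 0 <= num ip T v.
  by rewrite TE numB num_scalar // subr_ge0.
have q_l_gt0 s : 0 <= s <= M -> 0 < (q - l%:P).[s].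
  by move=> /q_gt0; rewrite hornerD hornerN hornerC; lra.
have [c c0 cT] : bounded_below T.
  apply: poly_bounded_below a0M _ _ => //.
    rewrite map_poly_eq0; apply/eqP => q0; have [v0 v0_gt0] := exists_nrm_gt0.
    have n0 := exprn_gt0 2 v0_gt0; have /andP[h1 h2] := a0M v0.
    have M0 : 0 <= M by rewrite -(pmulr_lge0 _ n0) (le_trans h1).
    by have := q_l_gt0 0; rewrite lexx M0 q0 horner0 ltxx => /(_ isT).
  move=> [s t] + [/= t0 sM]; rewrite t0 complexr0 /root horner_map /= => /eqP[].
  by move=> qs0; have := q_l_gt0 s sM; rewrite qs0 ltxx.
have [M' M'0 TM'] := op_bound T.
have TnumM' v : num ip T v <= M' * nrm v ^+ 2.
  by apply: le_trans (ler_norm _) _; exact: num_le.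
have sT : symm ip T by exact: symm_peval.
have T_sqr v := positive_sqr_le ip_norm M'0 sT T_ge0 TnumM' v.
have : l + c ^+ 2 / M' <= l; last first.
  by rewrite gerDl leNgt divr_gt0 // exprn_gt0.
apply: l_inf => v; rewrite mulrDl -lerBrDl.
have -> : num ip (peval a q) v - l * nrm v ^+ 2 = num ip T v.
  by rewrite TE numB num_scalar.
rewrite mulrAC ler_pdivrMr // [num _ _ _ * _]mulrC; apply: le_trans (T_sqr v).
by rewrite -exprMn lerXn2r ?nnegrE ?mulr_ge0 ?nrm_ge0 ?(ltW c0) ?cT.
Qed.

Lemma num_peval_le q1 q2 : (forall s, 0 <= s <= M -> q1.[s] <= q2.[s]) ->
  forall v, num ip (peval a q1) v <= num ip (peval a q2) v.
Proof.
move=> q12 v; apply/ler_addgt0Pl => e e0.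
have [v0|v0] := eqVneq (nrm v) 0.
  by rewrite (nrm0_eq0 v0) /num !ip0r; rewrite ltW // addr0.
have vp : 0 < nrm v ^+ 2 by rewrite exprn_gt0 // lt_neqAle eq_sym v0 nrm_ge0.
have q_gt0 s : 0 <= s <= M -> 0 < (q2 + (e / nrm v ^+ 2)%:P - q1).[s].
  move=> /q12; rewrite !hornerE; have := divr_gt0 e0 vp; lra.
have := num_peval_ge0 q_gt0 v.
rewrite rmorphB rmorphD /= pevalC numB numD num_scalar // divfK ?gt_eqF //.
by rewrite subr_ge0 addrC.
Qed.

(** The norm of [q(a) v] squared is the quadratic form of [q ^+ 2] at [a]. *)
Lemma nrm_peval_le q (e : R) : 0 <= e ->
  (forall s, 0 <= s <= M -> `|q.[s]| <= e) ->
  forall v, nrm (peval a q v) <= e * nrm v.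
Proof.
move=> e0 qe v; have sq : symm ip (peval a q) by exact: symm_peval.
rewrite -(@ler_pXn2r _ 2) ?nnegrE ?mulr_ge0 ?nrm_ge0 // exprMn.
have -> : nrm (peval a q v) ^+ 2 = num ip (peval a (q ^+ 2)) v.
  by rewrite rmorphXn /= expr2 /num opME sq Re_ip_nrm.
have -> : e ^+ 2 * nrm v ^+ 2 = num ip (peval a (e ^+ 2)%:P) v.
  by rewrite pevalC num_scalar.
apply: num_peval_le => s sM; rewrite horner_exp hornerC.
rewrite -[q.[s] ^+ 2]real_normK ?num_real //.
by rewrite lerXn2r ?nnegrE // qe.
Qed.

End Positive.

(** The iteration [P := P + (t - P^2) / (2M)] increases to the square root of [t]
    on [0, M^2]: at [t = s^2] the error is multiplied by [1 - (s + P) / (2M)],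
    which forces it below [2Ms / (2M + ns)] after [n] steps. *)
Lemma abs_poly_approx (M e : R) : 0 < M -> 0 < e ->
  exists P : {poly R}, forall s, 0 <= s <= M -> `|s - P.[s ^+ 2]| <= e.
Proof.
move=> M0 e0.
pose P := fix P n : {poly R} := if n is n'.+1 then
  P n' + (2 * M)^-1 *: ('X - P n' ^+ 2) else 0.
have step n s : s - (P n.+1).[s ^+ 2] =
    (s - (P n).[s ^+ 2]) * (1 - (2 * M)^-1 * (s + (P n).[s ^+ 2])).
  rewrite /= !hornerE; ring.
have bound n s : 0 <= s <= M ->
    [/\ 0 <= (P n).[s ^+ 2], 0 <= s - (P n).[s ^+ 2] &
      (s - (P n).[s ^+ 2]) * (2 * M + n%:R * s) <= 2 * M * s].
  move=> /andP[s0 sM]; elim: n => [|n [IH0 IH1 IH2]].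
    by rewrite /= horner0 mul0r addr0 subr0 mulrC.
  have := step n s; set D := s - (P n).[s ^+ 2] in IH1 IH2 *.
  set w := (2 * M)^-1; have wM : w * (2 * M) = 1 by rewrite mulVf //; lra.
  have w0 : 0 < w by rewrite invr_gt0; lra.
  set p := (P n).[s ^+ 2] in IH0 D IH1 IH2 *; set p' := (P n.+1).[s ^+ 2] => DE.
  have ps : p <= s by rewrite /D in IH1; lra.
  have h1 : w * (s + p) <= 1 by rewrite -wM ler_pM2l //; lra.
  have h2 : 0 <= w * (s + p) by rewrite mulr_ge0 ?addr_ge0 // ltW.
  have h3 : D * (1 - w * (s + p)) <= D * (1 - w * s).
    by rewrite ler_wpM2l // lerD2l lerN2 ler_pM2l // lerDl.
  have D'0 : 0 <= s - p' by rewrite DE mulr_ge0 // subr_ge0.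
  have D'D : s - p' <= D by rewrite DE ler_piMr // gerBl.
  split=> //; first by rewrite /D in D'D; lra.
  have n0 : 0 <= n%:R :> R by [].
  have n1 : n.+1%:R = n%:R + 1 :> R by rewrite -natr1.
  have c0 : 0 <= 2 * M + n.+1%:R * s by rewrite addr_ge0 ?mulr_ge0 // ltW.
  rewrite DE; apply: le_trans (ler_wpM2r c0 h3) _; apply: le_trans IH2.
  rewrite -mulrA ler_wpM2l // n1.
  have e1 : w * s * (2 * M) = s by rewrite mulrAC wM mul1r.
  have e2 : 0 <= w * s * ((n%:R + 1) * s) by rewrite !mulr_ge0 ?addr_ge0 // ltW.
  lra.
have [n ne] : exists n : nat, 2 * M <= n%:R * e.
  exists (Num.truncn (2 * M / e)).+1; rewrite -ler_pdivrMr //.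
  exact/ltW/truncnS_gt.
exists (P n) => s sM; have [P0 sP sPn] := bound n s sM.
rewrite ger0_norm //; have [se|es] := leP s e; first by lra.
have n0 : 0 < n%:R :> R.
  by rewrite -(pmulr_lgt0 _ e0); apply: lt_le_trans ne; rewrite mulr_gt0.
rewrite -(ler_pM2l n0); apply: le_trans ne; have s0 := lt_trans e0 es.
rewrite -(ler_pM2r s0); apply: le_trans sPn.
have : 0 <= (s - (P n).[s ^+ 2]) * (2 * M) by rewrite mulr_ge0 // ltW ?mulr_gt0.
lra.
Qed.

Lemma comm_approx a b :
  (forall e : R, 0 < e -> exists c : B, GRing.comm b c /\
     forall v, nrm (c v - a v) <= e * nrm v) ->
  b * a = a * b.
Proof.
move=> approx; have [L L0 bL] := op_bound b.
apply: op_inj => v; apply/eqP; rewrite -subr_eq0; apply/eqP/nrm0_eq0/eqP.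
rewrite eq_le nrm_ge0 andbT; apply/ler_addgt0Pl => e' e'0; rewrite addr0.
(* The commutator at v is at most 2 L |v| times the error of approximation. *)
pose n := 2 * L * nrm v + 1.
have n0 : 0 < n by rewrite ltr_wpDl // !mulr_ge0 ?nrm_ge0 // ltW.
have e0 : 0 < e' / n by rewrite divr_gt0.
have [c [bc ca]] := approx _ e0.
have -> : (b * a) v - (a * b) v = (c (b v) - a (b v)) - b (c v - a v).
  rewrite -!opBE -!opME -opBE mulrBl mulrBr bc.
  by congr (op _ v); rewrite opprB [RHS]addrC addrA subrK.
apply: le_trans (nrmB _ _) _.
apply: (@le_trans _ _ (e' / n * (2 * L * nrm v))); last first.
  by rewrite mulrAC ler_pdivrMr // ler_wpM2l ?ltW // /n; lra.
have := le_trans (bL (c v - a v)) (ler_wpM2l (ltW L0) (ca v)).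
have := le_trans (ca (b v)) (ler_wpM2l (ltW e0) (bL v)).
lra.
Qed.

(** By the approximation of [s] by polynomials in [s ^+ 2], the positive operator
    [a] is a norm limit of polynomials in [a ^+ 2]. *)
Lemma comm_sqr_comm a b : positive_op ip a ->
  b * (a ^+ 2) = a ^+ 2 * b -> b * a = a * b.
Proof.
move=> a0 ba2; have [M M0 aM] := op_bound a.
have numM v : num ip a v <= M * nrm v ^+ 2.
  by apply: le_trans (ler_norm _) _; exact: num_le.
apply: comm_approx => e e0; have [P PM] := abs_poly_approx M0 e0.
exists (peval a (P \Po 'X^2)); split.
  by rewrite peval_comp_sqr; exact: peval_comm.
pose q := (P \Po 'X^2) - 'X.
have qE : peval a q = peval a (P \Po 'X^2) - a by rewrite rmorphB /= pevalX.
move=> v; rewrite -opBE -qE; apply: (nrm_peval_le a0 numM); first exact: ltW.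
by move=> s /PM; rewrite hornerD hornerN hornerX horner_comp hornerXn distrC.
Qed.

End PositivityOfPolynomials.

(** * Traces on a von Neumann algebra *)

Section OperatorNorm.
Variables (R : realType) (H : completeNormedModType R[i]).
Implicit Types (x : H -> H) (v : H).

Let norm_values x := [set complex.Re `|x v| | v in [set v : H | `|v| <= 1]].

Lemma op_norm_bound x : bounded_op x ->
  forall v, nrm (x v) <= op_norm x * nrm v.
Proof.
move=> /bounded_opP[lx [M M0 xM]].
have sup_x : has_sup (norm_values x).
  split; first by exists (complex.Re `|x 0|), 0 => //=; rewrite normr0.
  exists M => _ [v /= v1 <-]; apply: le_trans (xM v) _.
  rewrite ler_piMr ?(ltW M0) //; move: v1.
  by rewrite nrmE -(rmorph1 (real_complex R)) lecR.
pose xl : {linear H -> H} := HB.pack x (GRing.isLinear.Build _ _ _ _ x lx).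
move=> v; have [v0|v0] := eqVneq (nrm v) 0.
  by rewrite v0 (nrm0_eq0 v0) mulr0 -[x]/(xl : _ -> _) raddf0 nrm0.
have vp : 0 < nrm v by rewrite lt_neqAle eq_sym v0 nrm_ge0.
have : nrm (x ((nrm v)^-1%:C%C *: v)) <= op_norm x.
  apply: (sup_upper_bound sup_x); exists ((nrm v)^-1%:C%C *: v) => //=.
  by rewrite nrmE nrmZr ger0_norm ?invr_ge0 ?nrm_ge0 // mulVf.
rewrite -[x]/(xl : _ -> _) linearZ nrmZr ger0_norm ?invr_ge0 ?nrm_ge0 //.
by rewrite ler_pdivrMl // mulrC.
Qed.

End OperatorNorm.

Lemma poly_opE (R : realType) (H : completeNormedModType R[i])
    (N : set (H -> H)) (hN : operator_algebra N) (a : algebra_of hN) q :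
  poly_op q a = peval a q.
Proof.
apply/funext => v; rewrite peval_sum op_sumE.
by apply: eq_bigr => i _; rewrite opZE opXE.
Qed.

Section VonNeumannTrace.
Variables (R : realType) (H : completeNormedModType R[i]).
Variable ip : {dot H for (@Num.conj R[i])}.
Hypothesis ip_norm : forall v : H, ip v v = `|v| ^+ 2.
Hypothesis H_nontrivial : (idfun : H -> H) <> 0.
Variables (N : set (H -> H)) (hN : von_neumann_algebra ip N).
Implicit Types (x y z : H -> H) (u v w : H).

Local Notation B := (algebra_of (bounded_op_algebra H_nontrivial)).

Lemma vna_operator_algebra : operator_algebra N.
Proof.
case: hN => bdd unit lin mul _ _; split=> //.
by move=> x /bdd[].
Qed.

Lemma adjoint_unique x y : bounded_op y ->
  (forall u v, ip (x u) v = ip u (y v)) -> adjoint ip x = y.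
Proof.
move=> by_ xy; apply: xget_unique => // z [_ xz]; apply/funext => v.
apply/eqP; rewrite -subr_eq0 -(dnorm_eq0 ip) /= ipBr -xz -xy.
by rewrite subrr.
Qed.

(** Elements whose adjoint really is one; on them the chosen adjoint is a
    genuine involution. Every symmetric element of [N] belongs to this set. *)
Definition star_closed : set (H -> H) :=
  [set x | N x /\ forall u v, ip (x u) v = ip u (adjoint ip x v)].

Lemma star_closedP x y : N x -> N y -> (forall u v, ip (x u) v = ip u (y v)) ->
  star_closed x /\ adjoint ip x = y.
Proof.
move=> Nx Ny xy; have xE : adjoint ip x = y.
  by apply: adjoint_unique => //; exact: (vna_bounded hN).
by split=> //; split; rewrite ?xE.
Qed.

Lemma adjoint_lin (c : R[i]) x y : star_closed x -> star_closed y ->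
  star_closed (c *: x + y) /\
  adjoint ip (c *: x + y) = c^*%C *: adjoint ip x + adjoint ip y.
Proof.
move=> [Nx xE] [Ny yE]; apply: star_closedP.
- exact: (vna_lin hN).
- by apply: (vna_lin hN); exact: (vna_adjoint hN).
by move=> u v; rewrite !fctE ipDl ipZl xE yE ipDr ipZr conjcK.
Qed.

Lemma adjoint_mul x y : star_closed x -> star_closed y ->
  star_closed (x \o y) /\ adjoint ip (x \o y) = adjoint ip y \o adjoint ip x.
Proof.
move=> [Nx xE] [Ny yE]; apply: star_closedP.
- exact: (vna_mul hN).
- by apply: (vna_mul hN); exact: (vna_adjoint hN).
by move=> u v /=; rewrite xE yE.
Qed.

Lemma adjoint_star_closed x : star_closed x -> star_closed (adjoint ip x).
Proof.
move=> [Nx xE]; have [] // := @star_closedP (adjoint ip x) x.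
- exact: (vna_adjoint hN).
- by move=> u v; rewrite ipC -xE -ipC.
Qed.

Lemma symm_star_closed x : N x -> symm ip x ->
  star_closed x /\ adjoint ip x = x.
Proof. by move=> Nx sx; exact: star_closedP. Qed.

Lemma star_closed_algebra : operator_algebra star_closed.
Proof.
split=> //.
- by move=> x [Nx _]; exact: (oa_linear vna_operator_algebra).
- by have [] := @symm_star_closed idfun (vna_unit hN) (fun _ _ => erefl).
- by move=> c x y Nx Ny; exact: (adjoint_lin c Nx Ny).1.
- by move=> x y Nx Ny; exact: (adjoint_mul Nx Ny).1.
Qed.

Local Notation A := (algebra_of star_closed_algebra).

Definition op_star (a : A) : A := OperatorIn (adjoint_star_closed (op_in a)).

Lemma op_op_star (a : A) : op (op_star a) = adjoint ip (op a).
Proof. by []. Qed.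

Fact op_star_zmod_morphism : zmod_morphism op_star.
Proof.
move=> a b; apply: op_inj => v; rewrite opBE !op_op_star.
have -> : op (a - b) = (-1) *: op b + op a.
  by apply/funext => w; rewrite opBE !fctE scaleN1r addrC.
rewrite (adjoint_lin (-1) (op_in b) (op_in a)).2 !fctE.
by rewrite rmorphN1 scaleN1r addrC.
Qed.

HB.instance Definition _ :=
  GRing.isZmodMorphism.Build A A op_star op_star_zmod_morphism.

Lemma op_starM (a b : A) : op_star (a * b) = op_star b * op_star a.
Proof.
apply: op_inj => v; rewrite opME !op_op_star.
by rewrite (adjoint_mul (op_in a) (op_in b)).2.
Qed.

Lemma op_starZ1 (c : R) : op_star (c%:C%C *: 1) = c%:C%C *: 1.
Proof.
apply: op_inj => v; rewrite op_op_star.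
rewrite (@symm_star_closed (op (c%:C%C *: 1 : A)) _ _).2 //.
  by have [] := op_in (c%:C%C *: 1 : A).
by move=> u w; rewrite !opZE !op1E ipZl ipZr conjc_real.
Qed.

Section Trace.
Variables (tau : (H -> H) -> R[i]) (htau : nff_trace ip N tau).

Definition re_tau x : R := complex.Re (tau x).

Lemma re_tau_lin (c : R) x y : N x -> N y ->
  re_tau (c%:C%C *: x + y) = c * re_tau x + re_tau y.
Proof.
move=> Nx Ny; rewrite /re_tau (trace_lin htau) // raddfD /=; congr (_ + _).
by case: (tau x) => p q /=; ring.
Qed.

Lemma re_tau_ge0 x : N x -> positive_op ip x -> 0 <= re_tau x.
Proof.
by move=> Nx x0; have := trace_ge0 htau Nx x0; rewrite lecE => /andP[].
Qed.

Definition trace_fun (_ : nff_trace ip N tau) (a : A) : R := re_tau a.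
Local Notation phi := (trace_fun htau).

Fact trace_fun_zmod_morphism : zmod_morphism phi.
Proof.
move=> a b; rewrite /trace_fun.
have -> : op (a - b) = (-1)%:C%C *: op b + op a.
  by apply/funext => w; rewrite opBE !fctE rmorphN1 scaleN1r addrC.
rewrite re_tau_lin ?mulN1r 1?addrC //; first by have [] := op_in b.
by have [] := op_in a.
Qed.

HB.instance Definition _ :=
  GRing.isZmodMorphism.Build A R phi trace_fun_zmod_morphism.

Lemma trace_funZ (c : R) (a : A) : phi (c%:C%C *: a) = c * phi a.
Proof.
have [Na _] := op_in a; have [N0 _] := op_in (0 : A).
have tau0 : re_tau (op (0 : A)) = 0 by exact: (raddf0 phi).
rewrite /trace_fun -[RHS]addr0 -tau0 -re_tau_lin //; congr (re_tau _).
by apply/funext => v; rewrite opZE !fctE op0E addr0.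
Qed.

Lemma trace_funC (a b : A) : phi (a * b) = phi (b * a).
Proof.
have [Na _] := op_in a; have [Nb _] := op_in b.
by rewrite /trace_fun /re_tau (trace_comm htau Na Nb : tau (op (a * b)) = _).
Qed.

Lemma trace_fun_ge0 (a : A) : positive_op ip a -> 0 <= phi a.
Proof. by have [Na _] := op_in a; exact: re_tau_ge0. Qed.

Lemma op_starE (a : A) u v : ip (a u) v = ip u (op_star a v).
Proof. by have [_] := op_in a; apply. Qed.

Lemma op_starE' (a : A) u v : ip (op_star a u) v = ip u (a v).
Proof. by rewrite ipC -op_starE -ipC. Qed.

Lemma trace_fun_star_ge0 (a : A) : 0 <= phi (op_star a * a).
Proof.
by apply: trace_fun_ge0 => v; rewrite opME op_starE' ip_norm exprn_ge0.
Qed.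

End Trace.
End VonNeumannTrace.

(** * Functional calculus and trace norms *)

Section FunctionalCalculusTrace.
Variables (R : realType) (H : completeNormedModType R[i]).
Variable ip : {dot H for (@Num.conj R[i])}.
Hypothesis ip_norm : forall v : H, ip v v = `|v| ^+ 2.
Hypothesis H_nontrivial : (idfun : H -> H) <> 0.
Variables (N : set (H -> H)) (hN : von_neumann_algebra ip N).
Implicit Types (x y z : H -> H) (u v w : H).

Local Notation B := (algebra_of (bounded_op_algebra H_nontrivial)).

Lemma comm_opP (a b : B) :
  a * b = b * a <-> (op a) \o (op b) = (op b) \o (op a).
Proof.
split=> [ab|ab]; first by apply/funext => v /=; rewrite -!opME ab.
by apply: op_inj => v; rewrite !opME; have := congr1 (@^~ v) ab.
Qed.

(** Whatever commutes with [x \o x] commutes with the positive operator [x], so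
    [x] lies in the bicommutant. *)
Lemma sqrt_in_vna x : bounded_op x -> positive_op ip x -> N (x \o x) -> N x.
Proof.
move=> bx x0 Nxx; rewrite -(vna_bicommutant hN); split=> // z [bz zN].
pose a : B := OperatorIn bx; pose b : B := OperatorIn bz.
suff /comm_opP : a * b = b * a by [].
apply/esym/(comm_sqr_comm ip_norm) => //.
by rewrite !expr2; apply/comm_opP; exact: zN.
Qed.

(** The property by which a value of the functional calculus is chosen. *)
Definition is_fun_calc (f : R -> R) x y := bounded_op y /\
  forall e : R, 0 < e -> exists q : {poly R},
    (forall s : R, 0 <= s <= op_norm x -> `|q.[s] - f s| <= e) /\
    op_norm (poly_op q x - y) <= e.

Lemma is_fun_calc_approx f (a : B) y : is_fun_calc f a y ->
  forall e : R, 0 < e -> exists q : {poly R},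
    (forall s : R, 0 <= s <= op_norm a -> `|q.[s] - f s| <= e) /\
    forall v, nrm (peval a q v - y v) <= e * nrm v.
Proof.
move=> [bdd_y approx] e /approx[q [qf qy]]; exists q; split=> // v.
pose b : B := OperatorIn bdd_y.
rewrite -[y v]/(b v) -opBE; apply: le_trans (op_norm_bound _ v) _.
  exact: op_in.
apply: ler_wpM2r; first exact: nrm_ge0.
suff -> : op (peval a q - b) = poly_op q a - y by [].
by apply/funext => w; rewrite poly_opE opBE.
Qed.

Lemma fun_calc_in_vna f x y : bounded_op x -> N x -> is_fun_calc f x y -> N y.
Proof.
move=> bx Nx yP; have [by_ _] := yP.
rewrite -(vna_bicommutant hN); split=> // z [bz zN].
pose a : B := OperatorIn bx; pose b : B := OperatorIn by_.
pose c : B := OperatorIn bz.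
suff /comm_opP : b * c = c * b by [].
have ca : GRing.comm c a by apply/comm_opP; exact: zN.
apply/esym/comm_approx => e e0.
have [q [_ qe]] := is_fun_calc_approx (a := a) yP e0.
by exists (peval a q); split; [exact: peval_comm | exact: qe].
Qed.

(** An approximating polynomial lies between [- e] and [g + e] on the spectrum;
    positivity transfers these bounds to its value at [a], and [e] tends to [0].
    The same limit shows that the quadratic form of [y] is real. *)
Lemma fun_calc_num_le f (a : B) y (g : {poly R}) :
  positive_op ip a -> is_fun_calc f a y ->
  (forall s, 0 <= s -> 0 <= f s <= g.[s]) ->
  positive_op ip y /\ positive_op ip (op (peval a g) - y).
Proof.
move=> a0 yP fg; have [by_ _] := yP; pose b : B := OperatorIn by_.
have aM v : num ip a v <= op_norm a * nrm v ^+ 2.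
  apply: le_trans (ler_norm _) _; apply: (num_le ip_norm).
  exact: (op_norm_bound (op_in a)).
have sa : symm ip a by exact: positive_symm.
have approx e v : 0 < e -> exists q : {poly R},
    [/\ forall s, 0 <= s <= op_norm a -> - e <= q.[s] <= g.[s] + e,
        `|num ip (peval a q) v - num ip b v| <= e * nrm v ^+ 2 &
        `|complex.Im (ip (b v) v)| <= e * nrm v ^+ 2].
  move=> e0; have [q [qf qe]] := is_fun_calc_approx (a := a) yP e0.
  exists q; split.
  - move=> s sM; have := qf s sM; have /andP[s0 _] := sM.
    by have /andP[] := fg s s0; rewrite ler_norml => ? ? /andP[]; lra.
  - by rewrite -numB; apply: (num_le ip_norm); rewrite opBE; exact: qe.
  - have -> : complex.Im (ip (b v) v) = - complex.Im (ip ((peval a q - b) v) v).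
      rewrite opBE ipBl raddfB /= (symm_real v (symm_peval q sa)).
      by rewrite sub0r opprK.
    rewrite normrN; apply: le_trans (normr_Im_ip_le ip_norm _ _) _.
    by rewrite expr2 mulrA ler_wpM2r ?nrm_ge0 // opBE; exact: qe.
have eps_le (c d : R) v :
    (forall e, 0 < e -> c <= d + 2 * (e * nrm v ^+ 2)) -> c <= d.
  move=> cd; apply/ler_addgt0Pl => e e0.
  have n0 : 0 < 2 * nrm v ^+ 2 + 1 by rewrite ltr_wpDl // mulr_ge0 // sqr_ge0.
  apply: le_trans (cd (e / (2 * nrm v ^+ 2 + 1)) (divr_gt0 e0 n0)) _.
  rewrite addrC lerD2r mulrCA mulrAC ler_pdivrMr // ler_wpM2l ?ltW //; lra.
have real_b v : complex.Im (ip (b v) v) = 0.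
  apply/eqP; rewrite -normr_le0; apply: (eps_le _ _ v) => e e0.
  have [q [_ _ im_le]] := approx e v e0; rewrite add0r.
  have := mulr_ge0 (ltW e0) (sqr_ge0 (nrm v)); lra.
split.
  apply/positive_opP => v; split; first exact: real_b.
  apply: (eps_le _ _ v) => e e0; have [q [qf qe _]] := approx e v e0.
  have : num ip (peval a (- e)%:P) v <= num ip (peval a q) v.
    apply: (num_peval_le ip_norm a0 aM) => s /qf/andP[].
    by rewrite hornerC.
  rewrite pevalC num_scalar //; move: qe; rewrite ler_norml => /andP[].
  by rewrite -[num ip y v]/(num ip b v); lra.
suff h : positive_op ip (peval a g - b).
  by move=> v; have := h v; rewrite opBE.
apply/positive_opP => v; split.
  by rewrite opBE ipBl raddfB /= real_b (symm_real v (symm_peval g sa)) subr0.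
rewrite numB subr_ge0; apply: (eps_le _ _ v) => e e0.
have [q [qf qe _]] := approx e v e0.
have : num ip (peval a q) v <= num ip (peval a (g + e%:P)) v.
  apply: (num_peval_le ip_norm a0 aM) => s /qf/andP[_].
  by rewrite hornerD hornerC.
rewrite rmorphD /= pevalC numD num_scalar //.
by move: qe; rewrite ler_norml => /andP[]; lra.
Qed.

End FunctionalCalculusTrace.

(** Weighted arithmetic-geometric inequality between [(s / B) ^ 2q] and [1]. *)
Lemma powR_young (R : realType) (p B s : R) (q : nat) :
  0 < p -> p < q.*2%:R -> 0 < B -> 0 <= s ->
  s `^ p <= p / q.*2%:R * (B `^ p / B ^+ q.*2) * s ^+ q.*2 +
            (1 - p / q.*2%:R) * B `^ p.
Proof.
move=> p0 pq B0 s0; set n : R := q.*2%:R.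
have n0 : 0 < n by exact: lt_trans pq.
have th1 : 0 < 1 - p / n by rewrite subr_gt0 ltr_pdivrMr // mul1r.
have sB : 0 <= s / B by rewrite divr_ge0 // ltW.
have := @conjugate_powR R ((s / B) `^ p) 1 (n / p) (1 - p / n)^-1
  (powR_ge0 _ _) ler01 (divr_gt0 n0 p0).
have th : p / n + (1 - p / n) = 1 by ring.
rewrite invr_gt0 invrK invf_div powR1 mulr1 mul1r => /(_ th1 th).
have -> : ((s / B) `^ p) `^ (n / p) = (s / B) ^+ q.*2.
  by rewrite -powRrM mulrCA divff ?gt_eqF // mulr1 powR_mulrn.
move=> h; have Bp : 0 < B `^ p by exact: powR_gt0.
have -> : s `^ p = B `^ p * (s / B) `^ p.
  by rewrite -powRM ?(ltW B0) // mulrCA divff ?gt_eqF // mulr1.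
apply: le_trans (ler_wpM2l (ltW Bp) h) _.
rewrite expr_div_n mulrDr [_ * (1 - _)]mulrC lerD2r.
by rewrite le_eqVlt; apply/orP; left; apply/eqP; ring.
Qed.

Section TraceNorm.
Variables (R : realType) (H : completeNormedModType R[i]).
Variable ip : {dot H for (@Num.conj R[i])}.
Hypothesis ip_norm : forall v : H, ip v v = `|v| ^+ 2.
Hypothesis H_nontrivial : (idfun : H -> H) <> 0.
Variables (N : set (H -> H)) (hN : von_neumann_algebra ip N).
Variables (tau : (H -> H) -> R[i]) (htau : nff_trace ip N tau).
Implicit Types (x y z : H -> H) (u v w : H).

Local Notation B := (algebra_of (bounded_op_algebra H_nontrivial)).
Let hNA := vna_operator_algebra H_nontrivial hN.
Local Notation T := (re_tau tau).

Let T_lin (c : R) x y : N x -> N y -> T (c%:C%C *: x + y) = c * T x + T y.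
Proof. exact: (re_tau_lin htau). Qed.

Lemma re_tau0 : T 0 = 0.
Proof.
have N0 := oa_zero hNA; have := T_lin 1 N0 N0.
by rewrite scale1r addr0; lra.
Qed.

Lemma iter_in_vna n x : N x -> N (iter n x).
Proof.
move=> Nx; elim: n => [|n IHn]; first exact: oa_unit hNA.
exact: (oa_mul hNA Nx IHn).
Qed.

(** If no operator has the property required by the functional calculus, its value
    is [0], and the bound only says that the right-hand side is nonnegative. *)
Lemma fun_calc_trace f x (al be : R) n : N x -> positive_op ip x ->
  0 <= al -> 0 <= be ->
  (forall s, 0 <= s -> 0 <= f s <= al * s ^+ n + be) ->
  0 <= T (fun_calc f x) <= al * T (iter n x) + be * T idfun.
Proof.
move=> Nx x0 al0 be0 fle; have bx := vna_bounded hN Nx.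
pose a : B := OperatorIn bx; have Nn := iter_in_vna n Nx.
have gE : op (peval a (al *: 'X^n + be%:P)) =
    al%:C%C *: (iter n x : H -> H) + (be%:C%C *: (idfun : H -> H) + 0).
  apply/funext => v; rewrite rmorphD /= pevalZ rmorphXn /= pevalX pevalC.
  by rewrite opDE !opZE opXE op1E !fctE addr0.
have Tid : 0 <= T idfun.
  apply: (re_tau_ge0 htau); first exact: oa_unit hNA.
  by move=> v; rewrite ip_norm exprn_ge0.
have N1 := oa_unit hNA; have N0 := oa_zero hNA.
have Nbe : N (be%:C%C *: (idfun : H -> H) + 0) by exact: (oa_lin hNA _ N1 N0).
have Tg : T (peval a (al *: 'X^n + be%:P)) = al * T (iter n x) + be * T idfun.
  by rewrite gE !T_lin // re_tau0 addr0.
have Tn : 0 <= T (iter n x).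
  apply: (re_tau_ge0 htau) => // v.
  have sa : symm ip (op a) by exact: (@positive_symm _ _ _ a).
  have <- : (a ^+ n) v = iter n x v by rewrite opXE.
  have <- : peval a 'X^n = a ^+ n by rewrite rmorphXn /= pevalX.
  apply: (symm_positive (symm_peval _ sa)) => w.
  have <- : num ip (peval a 0) w = 0.
    by rewrite rmorph0 /num op0E ip0l.
  apply: (@num_peval_le _ _ _ ip_norm H_nontrivial a (op_norm x) x0).
    move=> u; apply: le_trans (ler_norm _) _; apply: (num_le ip_norm).
    exact: op_norm_bound.
  by move=> s /andP[s0 _]; rewrite horner0 hornerXn exprn_ge0.
rewrite /fun_calc; case: xgetP => [y _ yP|_]; last first.
  by rewrite re_tau0 lexx addr_ge0 ?mulr_ge0.
have Ny : N y by exact: (fun_calc_in_vna H_nontrivial hN bx Nx yP).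
have [|y0 yg] := @fun_calc_num_le _ _ _ ip_norm H_nontrivial f a y
  (al *: 'X^n + be%:P) x0 yP.
  by move=> s /fle; rewrite hornerD hornerZ hornerXn hornerC.
rewrite (re_tau_ge0 htau Ny y0) /= -Tg -subr_ge0.
have Ng : N (op (peval a (al *: 'X^n + be%:P))).
  by rewrite gE; exact: (oa_lin hNA _ Nn Nbe).
have -> : T (op (peval a (al *: 'X^n + be%:P))) - T y =
    T ((-1)%:C%C *: y + op (peval a (al *: 'X^n + be%:P))).
  by rewrite T_lin // mulN1r addrC.
apply: (re_tau_ge0 htau).
  exact: (oa_lin hNA _ Ny Ng).
by rewrite rmorphN1 scaleN1r addrC.
Qed.

(** The even powers of a square root of [y^* y = y ^ 2] are those of [y]. The
    inequality covers the default value [0] of the absolute value; it needs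
    [0 < q], the power [0] of the zero operator being the identity. *)
Lemma abs_op_moment y q : N y -> symm ip y -> (0 < q)%N ->
  [/\ N (abs_op ip y), positive_op ip (abs_op ip y) &
      T (iter q.*2 (abs_op ip y)) <= T (iter q.*2 y)].
Proof.
move=> Ny sy q0; have adj_y : adjoint ip y = y.
  exact: (symm_star_closed hN Ny sy).2.
have iter_sqr z : iter q.*2 z = iter q (z \o z).
  by apply/funext => v; elim: q {q0} => //= q ->.
rewrite /abs_op; case: xgetP => [a _ [ba a0 aa]|_].
  rewrite adj_y in aa; split=> //; last by rewrite !iter_sqr aa.
  apply: (sqrt_in_vna ip_norm H_nontrivial hN) => //.
  by rewrite aa; exact: (oa_mul hNA Ny Ny).
split; first exact: oa_zero hNA.
  by move=> v; rewrite ip0l.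
have -> : iter q.*2 (0 : H -> H) = 0.
  by case: q q0 {iter_sqr} => // q _; apply/funext.
rewrite re_tau0; apply: (re_tau_ge0 htau); first exact: iter_in_vna.
rewrite -addnn => v; rewrite iterD.
have iter_symm n u w : ip (iter n y u) w = ip u (iter n y w).
  by elim: n w => // n IHn w; rewrite iterS sy IHn -iterSr.
by rewrite iter_symm ip_norm exprn_ge0.
Qed.

Lemma nc_Lnorm_powR_le y p M q : N y -> symm ip y -> 0 < p -> p < q.*2%:R ->
  0 < M ->
  nc_Lnorm ip tau p%:E y `^ p <=
    p / q.*2%:R * (M `^ p / M ^+ q.*2) * T (iter q.*2 y) +
    (1 - p / q.*2%:R) * M `^ p * T idfun.
Proof.
move=> Ny sy p0 pq M0; have q0 : (0 < q)%N.
  by case: q pq => // /(lt_trans p0); rewrite ltxx.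
have n0 : 0 < q.*2%:R :> R by exact: lt_trans pq.
have [Na a0 Ta] := abs_op_moment Ny sy q0.
have al0 : 0 <= p / q.*2%:R * (M `^ p / M ^+ q.*2).
  by rewrite mulr_ge0 // divr_ge0 ?powR_ge0 ?exprn_ge0 // ltW.
have be0 : 0 <= (1 - p / q.*2%:R) * M `^ p.
  by rewrite mulr_ge0 ?powR_ge0 // subr_ge0 ler_pdivrMr // mul1r ltW.
have /andP[T0 Tle] : 0 <= T (fun_calc (fun s => s `^ p) (abs_op ip y)) <=
    p / q.*2%:R * (M `^ p / M ^+ q.*2) * T (iter q.*2 (abs_op ip y)) +
    (1 - p / q.*2%:R) * M `^ p * T idfun.
  by apply: fun_calc_trace => // s s0; rewrite powR_ge0 powR_young.
rewrite /nc_Lnorm -powRrM mulVf ?gt_eqF // powRr1 //.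
by apply: le_trans Tle _; rewrite lerD2r ler_wpM2l.
Qed.

End TraceNorm.

(** * Moments of the sampled operator *)

Section SampledOperators.
Variables (R : realType) (H : completeNormedModType R[i]).
Variable ip : {dot H for (@Num.conj R[i])}.
Hypothesis ip_norm : forall v : H, ip v v = `|v| ^+ 2.
Hypothesis H_nontrivial : (idfun : H -> H) <> 0.
Variables (N : set (H -> H)) (hN : von_neumann_algebra ip N).
Variables (m : nat) (x : 'I_m -> H -> H) (r k : R).
Hypothesis x_pos : forall j, N (x j) /\ positive_op ip (x j).
Hypothesis x_mean : (m%:R^-1 : R[i]) *: (\sum_(j < m) x j) = idfun.
Hypothesis x_norm : forall j, op_norm (x j) <= r.
Hypothesis km : 0 < k <= m%:R.

Local Notation A := (algebra_of (star_closed_algebra H_nontrivial hN)).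

Definition sampled (J : {set 'I_m}) : H -> H :=
  sample_dev k x (fun j => (j \in J)%:R).

Let k0 : 0 < k. Proof. by case/andP: km. Qed.
Let m0 : 0 < m%:R :> R. Proof. by case/andP: km => /lt_le_trans; apply. Qed.
Let kap := k / m%:R.

Lemma selection_rate01 : 0 <= kap <= 1.
Proof.
case/andP: km => _ k_le; apply/andP; split; first by rewrite divr_ge0 // ltW.
by rewrite /kap ler_pdivrMr // mul1r.
Qed.

Let x_symm j : symm ip (x j).
Proof.
have [Nx x0] := x_pos j; have [lx _] := vna_bounded hN Nx.
pose xl : {linear H -> H} :=
  HB.pack (x j) (GRing.isLinear.Build _ _ _ _ (x j) lx).
exact: (@positive_symm _ _ _ xl).
Qed.

Let x_star j : star_closed ip N (x j).
Proof.
by have [Nx _] := x_pos j; have [] := symm_star_closed hN Nx (@x_symm j).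
Qed.

Let xA j : A := OperatorIn (x_star j).
Let yA j : A := (k^-1)%:C%C *: xA j.

Let mean_mE v : v = (m%:R^-1 : R)%:C%C *: \sum_(j < m) x j v.
Proof.
have := congr1 (@^~ v) x_mean; rewrite !fctE fct_sumE => h.
by rewrite fmorphV rmorph_nat h.
Qed.

(** The average of the [x j] is the identity of a nontrivial space. *)
Lemma norm_bound_gt0 : 0 < r.
Proof.
rewrite ltNge; apply/negP => r0; apply: H_nontrivial; apply/funext => v.
rewrite [LHS]mean_mE big1 ?scaler0 // => j _; apply: nrm0_eq0.
apply/eqP; rewrite eq_le nrm_ge0 andbT.
apply: le_trans (op_norm_bound (vna_bounded hN (x_pos j).1) v) _.
by rewrite mulr_le0_ge0 ?nrm_ge0 // (le_trans (x_norm j)).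
Qed.

Let rho := r / k.
Let rho0 : 0 < rho. Proof. by rewrite divr_gt0 // norm_bound_gt0. Qed.

Let sum_yA : \sum_j kap%:C%C *: yA j = 1%:C%C *: 1.
Proof.
apply: op_inj => v; rewrite scale1r op1E [RHS]mean_mE scaler_sumr op_sumE.
apply: eq_bigr => j _; rewrite !opZE scalerA -rmorphM; congr (_%:C%C *: _).
by rewrite /kap mulrAC divff ?mul1r // gt_eqF.
Qed.

(** Since [kap] times the sum of the [yA j] is [1], the deviation of the sample is
    a sum of centered terms. *)
Lemma sampledE J : op (centered_sample yA kap J) = sampled J.
Proof.
apply/funext => v; rewrite op_sumE /sampled /sample_dev !fctE fct_sumE.
rewrite [X in _ = _ - X]mean_mE !scaler_sumr -sumrB; apply: eq_bigr => j _.
rewrite !opZE !scalerA -!rmorphM -scalerBl -rmorphB /=; congr (_%:C%C *: _).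
by rewrite /kap; field; rewrite !gt_eqF.
Qed.

Let star_yA j : op_star (yA j) = yA j.
Proof.
apply: op_inj => v; rewrite op_op_star.
have := symm_star_closed hN (op_in (yA j)).1; case=> [|_ -> //].
by move=> u w; rewrite !opZE ipZl ipZr conjc_real x_symm.
Qed.

Let y_num_ge0 j v : 0 <= num ip (yA j) v.
Proof.
rewrite /num opZE ipZl; have [_ /positive_opP/(_ v)[_]] := x_pos j.
rewrite /num; case: (ip _ _) => p q /= p0; rewrite mul0r subr0 mulr_ge0 //.
by rewrite invr_ge0 ltW.
Qed.

Let y_sqr_le j v : nrm (yA j v) ^+ 2 <= rho * num ip (yA j) v.
Proof.
apply: (@positive_sqr_le _ _ _ ip_norm (yA j)) => //.
- by move=> u w; rewrite op_starE star_yA.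
- by move=> w; exact: y_num_ge0.
move=> w; apply: le_trans (ler_norm _) _; apply: (num_le ip_norm).
rewrite -[X in nrm X <= _]/(op (yA j) w) opZE nrmZr.
rewrite ger0_norm ?invr_ge0 ?(ltW k0) //.
rewrite /rho [r / k]mulrC -mulrA ler_pM2l ?invr_gt0 //.
apply: le_trans (op_norm_bound (vna_bounded hN (x_pos j).1) w) _.
by rewrite ler_wpM2r ?nrm_ge0.
Qed.

Section Trace.
Variables (tau : (H -> H) -> R[i]) (htau : nff_trace ip N tau).
Local Notation T := (re_tau tau).
Local Notation phi := (@trace_fun _ _ _ H_nontrivial _ hN _ htau).

Let phi_y_ge0 j (a : A) : 0 <= phi (op_star a * yA j * a).
Proof.
apply: trace_fun_ge0 => v; rewrite !opME op_starE'.
apply: (@symm_positive _ _ _ (yA j)) => [u w|w]; last exact: y_num_ge0.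
by rewrite op_starE star_yA.
Qed.

Let phi_y_sqr_le j (a : A) :
  phi (op_star a * yA j ^+ 2 * a) <= rho * phi (op_star a * yA j * a).
Proof.
rewrite -subr_ge0 -trace_funZ -raddfB /= scalerAl scalerAr -mulrBl -mulrBr.
apply: trace_fun_ge0 => v; rewrite !opME op_starE'.
have sy u w : ip (yA j u) w = ip u (yA j w) by rewrite op_starE star_yA.
apply: (@symm_positive _ _ _ (rho%:C%C *: yA j - yA j ^+ 2)) => [u w|w].
  by rewrite !opBE !opZE expr2 !opME ipBl ipBr ipZl ipZr conjc_real !sy.
have -> : num ip (rho%:C%C *: yA j - yA j ^+ 2) w =
    rho * num ip (yA j) w - nrm (yA j w) ^+ 2.
  rewrite /num opBE opZE expr2 opME ipBl ipZl raddfB /=.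
  rewrite (sy (yA j w)) ip_nrm //=.
  by case: (ip (yA j w) w) => p q /=; rewrite mul0r subr0.
by rewrite subr_ge0.
Qed.

Lemma sampled_moment_le q (n : R) : q.*2%:R <= n + 1 ->
  bern_mean kap (fun J => T (iter q.*2 (sampled J))) <=
  ((n * rho) ^+ 2 + 4 * (n * rho)) ^+ q * T idfun.
Proof.
move=> qn.
have := @sample_moment_le R A (@op_star _ _ _ H_nontrivial _ hN) phi
  (@op_starM _ _ _ H_nontrivial _ hN) (@op_starZ1 _ _ _ H_nontrivial _ hN)
  (@trace_funZ _ _ _ H_nontrivial _ hN _ htau)
  (@trace_funC _ _ _ H_nontrivial _ hN _ htau)
  (@trace_fun_star_ge0 _ _ _ ip_norm H_nontrivial _ hN _ htau)
  m yA rho kap 1 (ltW rho0) ler01 selection_rate01 star_yA phi_y_ge0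
  phi_y_sqr_le sum_yA q n qn.
rewrite mulr1 /sample_moment /trace_fun.
suff -> : (fun J => T (op (centered_sample yA kap J ^+ q.*2))) =
          (fun J => T (iter q.*2 (sampled J))) by [].
apply/funext => J; congr (T _); apply/funext => v.
by rewrite opXE sampledE.
Qed.

Lemma re_tau1_ge0 : 0 <= T idfun.
Proof.
apply: (re_tau_ge0 htau); first exact: (vna_unit hN).
by move=> v; rewrite ip_norm exprn_ge0.
Qed.

Lemma sampled_in_vna J : N (sampled J).
Proof. by rewrite -sampledE; have [] := op_in (centered_sample yA kap J). Qed.

Lemma sampled_symm J : symm ip (sampled J).
Proof.
move=> u v; rewrite -sampledE op_starE; congr (ip u (op _ v)).
rewrite raddf_sum; apply: eq_bigr => j _ /=.
rewrite -[X in _ *: X]mul1r scalerAl op_starM op_starZ1 star_yA.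
by rewrite -scalerAr -scalerAl mul1r mulr1.
Qed.

(** With [p < 2q <= p + 2] and [n = p + 1 <= 2p], the base of the moment bound is
    at most [(2 p rho)^2 + 8 p rho <= 12 max(sqrt(p rho), p rho)^2], which is below
    [M ^+ 2] for the constant [4]. *)
Lemma sampled_Lnorm_le p : 5 / 2 <= p ->
  bern_mean kap (fun J => nc_Lnorm ip tau p%:E (sampled J) `^ p) <=
  (4 * Num.max (Num.sqrt (p * r / k)) (p * r / k)) `^ p * T idfun.
Proof.
move=> p52; have p0 : 0 < p by lra.
pose q := (Num.truncn (p / 2)).+1.
have p20 : 0 <= p / 2 by rewrite divr_ge0 // ltW.
have /andP[trunc_le] := truncn_itv p20; rewrite -/q => trunc_gt.
have qS : q%:R = (Num.truncn (p / 2))%:R + 1 :> R by rewrite /q -addn1 natrD.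
have qE : q.*2%:R = 2 * q%:R :> R by rewrite -mul2n natrM.
have pq : p < q.*2%:R by rewrite qE; lra.
have qn : q.*2%:R <= (p + 1) + 1 by rewrite qE qS; lra.
set M := 4 * _; set s := Num.max _ _ in M *.
have prho : p * r / k = p * rho by rewrite /rho mulrA.
have pr0 : 0 < p * rho by rewrite mulr_gt0.
have s1 : p * rho <= s ^+ 2.
  rewrite -[leLHS]sqr_sqrtr ?(ltW pr0) // lerXn2r ?nnegrE ?sqrtr_ge0 //.
    by rewrite /s prho le_max sqrtr_ge0.
  by rewrite /s prho le_max lexx.
have s0 : p * rho <= s by rewrite /s prho le_max lexx orbT.
have M0 : 0 < M by rewrite mulr_gt0 // (lt_le_trans pr0).
have pn0 : 0 <= (p + 1) * rho by rewrite mulr_ge0 ?(ltW rho0) //; lra.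
have step : ((p + 1) * rho) ^+ 2 + 4 * ((p + 1) * rho) <= M ^+ 2.
  have h1 : (p + 1) * rho <= 2 * (p * rho).
    by rewrite mulrA ler_pM2r //; lra.
  have : ((p + 1) * rho) ^+ 2 <= (2 * s) ^+ 2.
    by rewrite lerXn2r ?nnegrE //; lra.
  rewrite /M !exprMn; lra.
have n0 : 0 < q.*2%:R :> R by exact: lt_trans pq.
have th : p / q.*2%:R <= 1 by rewrite ler_pdivrMr // mul1r ltW.
have Mp : 0 <= M `^ p by exact: powR_ge0.
have Mq : 0 < M ^+ q.*2 by exact: exprn_gt0.
have moment : bern_mean kap (fun J => T (iter q.*2 (sampled J))) <=
    M ^+ q.*2 * T idfun.
  apply: le_trans (sampled_moment_le qn) _; rewrite ler_wpM2r ?re_tau1_ge0 //.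
  rewrite -mul2n exprM lerXn2r ?nnegrE ?sqr_ge0 //.
  by rewrite addr_ge0 ?sqr_ge0 // mulr_ge0.
apply: (@le_trans _ _ (bern_mean kap (fun J =>
    p / q.*2%:R * (M `^ p / M ^+ q.*2) * T (iter q.*2 (sampled J)) +
    (1 - p / q.*2%:R) * M `^ p * T idfun))).
  apply: bern_mean_le => [|J]; first exact: selection_rate01.
  apply: (nc_Lnorm_powR_le ip_norm H_nontrivial hN htau) => //.
  - exact: sampled_in_vna.
  - exact: sampled_symm.
rewrite bern_meanD bern_meanZ bern_mean_cst.
have al0 : 0 <= p / q.*2%:R * (M `^ p / M ^+ q.*2).
  by rewrite mulr_ge0 ?divr_ge0 // ltW.
apply: le_trans (lerD (ler_wpM2l al0 moment) (lexx _)) _.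
rewrite le_eqVlt; apply/orP; left; apply/eqP.
by field; rewrite ?gt_eqF.
Qed.

End Trace.
End SampledOperators.

(** * Random selections *)

Section SelectedSet.
Context (d : measure_display) (T : measurableType d) (R : realType).
Variables (P : probability T R) (m : nat) (delta : 'I_m -> {RV P >-> R}).
Variable kap : R.
Hypotheses (delta_sel : forall j, selector (delta j))
  (delta_ind : independent delta)
  (delta_mean : forall j, ('E_P[delta j] = kap%:E)%E).

Definition selected (w : T) : {set 'I_m} := [set j | delta j w == 1].

Lemma selected_val w j : delta j w = (j \in selected w)%:R.
Proof.
by rewrite inE; case: (delta_sel j w) => ->; rewrite ?eqxx // eq_sym oner_eq0.
Qed.

Let mset (c : R) j : measurable (delta j @^-1` [set c]).
Proof. exact: measurable_funPTI (measurable_set1 _). Qed.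

Let prob1 j : P (delta j @^-1` [set 1]) = kap%:E.
Proof.
rewrite -(delta_mean j) unlock -[X in P X]setIT -integral_indic //.
apply: eq_integral => w _; congr (_%:E); rewrite indicE.
case: (delta_sel j w) => e; rewrite e.
  by rewrite memNset //= e => /esym/eqP; rewrite oner_eq0.
by rewrite mem_set.
Qed.

Let prob0 j : P (delta j @^-1` [set 0]) = (1 - kap)%:E.
Proof.
have -> : delta j @^-1` [set 0] = ~` (delta j @^-1` [set 1]).
  apply/seteqP; split=> w /=; first by move=> -> /esym/eqP; rewrite oner_eq0.
  by case: (delta_sel j w).
by rewrite probability_setC // prob1.
Qed.

Let event (J : {set 'I_m}) := [set w | selected w = J].

Let eventE J : event J = \bigcap_(i in [set` [set: 'I_m]%SET])
  (delta i @^-1` (if i \in J then [set 1] else [set 0])).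
Proof.
apply/seteqP; split=> w /=.
  by move=> <- i _ /=; rewrite selected_val; case: ifP.
move=> h; apply/setP => i; have := h i; rewrite /= finset.in_setT => /(_ isT).
by rewrite inE; case: (i \in J) => /= ->; rewrite ?eqxx // eq_sym oner_eq0.
Qed.

Let event_measurable J : measurable (event J).
Proof.
rewrite eventE; apply: fin_bigcap_measurable => [|i _]; first exact: finite_finset.
by case: ifP => _; exact: mset.
Qed.

Lemma prob_selected J : P (event J) = (bern_weight kap J)%:E.
Proof.
rewrite eventE delta_ind; last by move=> i; case: ifP.
rewrite /bern_weight -prodEFin; apply: eq_big => [i|i _].
  by rewrite finset.in_setT.
by case: ifP => _; [exact: prob1 | exact: prob0].
Qed.

Lemma integral_selected (G : {set 'I_m} -> R) : (forall J, 0 <= G J) ->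
  (\int[P]_w (G (selected w))%:E = (bern_mean kap G)%:E)%E.
Proof.
move=> G0.
transitivity (\int[P]_w (\sum_(J : {set 'I_m}) (G J)%:E * (\1_(event J) w)%:E))%E.
  apply: eq_integral => w _.
  rewrite (bigD1 (selected w)) //= indicE mem_set //= mule1 big1 ?adde0 //.
  move=> J wJ; rewrite indicE memNset ?mule0 //=.
  by move=> e; rewrite -e eqxx in wJ.
rewrite ge0_integral_sum //; last 2 first.
- move=> J; apply: measurable_funeM; apply/measurable_realfun.measurable_EFinP.
  exact: measurable_realfun.measurable_indic.
- by move=> J w _; rewrite mule_ge0 // lee_fin.
rewrite /bern_mean -sumEFin; apply: eq_bigr => J _.
rewrite ge0_integralZl_EFin //; last first.
  apply/measurable_realfun.measurable_EFinP.
  exact: measurable_realfun.measurable_indic.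
rewrite integral_indic // setIT [X in (_ * X)%E](prob_selected J).
by rewrite -EFinM mulrC.
Qed.

Lemma expectation_selected (G : {set 'I_m} -> R) : (forall J, 0 <= G J) ->
  ('E_P[fun w => G (selected w)] = (bern_mean kap G)%:E)%E.
Proof. by move=> G0; rewrite unlock; exact: integral_selected. Qed.

Lemma prob_selected_in (Q : pred {set 'I_m}) :
  P [set w | Q (selected w)] = (bern_mean kap (fun J => (Q J)%:R))%:E.
Proof.
rewrite -integral_selected //.
have mQ : measurable [set w | Q (selected w)].
  have -> : [set w | Q (selected w)] = \bigcup_(J in [set` Q]) event J.
    apply/seteqP; split=> w /=; first by move=> Qw; exists (selected w).
    by move=> [J QJ wJ]; rewrite wJ.
  by apply: fin_bigcup_measurable => // J _; exact: event_measurable.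
rewrite -[X in P X]setIT -integral_indic //; apply: eq_integral => w _.
rewrite indicE; congr (_%:R%:E); case: (boolP (Q (selected w))) => Qw.
  by rewrite mem_set.
by rewrite memNset //= (negbTE Qw).
Qed.

End SelectedSet.

(** * Tail bound *)

Section Tail.
Variables (R : realType) (H : completeNormedModType R[i]).
Variable ip : {dot H for (@Num.conj R[i])}.
Hypothesis ip_norm : forall v : H, ip v v = `|v| ^+ 2.
Hypothesis H_nontrivial : (idfun : H -> H) <> 0.
Variables (N : set (H -> H)) (hN : von_neumann_algebra ip N).
Variables (m : nat) (x : 'I_m -> H -> H) (r k : R).
Hypothesis x_pos : forall j, N (x j) /\ positive_op ip (x j).
Hypothesis x_mean : (m%:R^-1 : R[i]) *: (\sum_(j < m) x j) = idfun.
Hypothesis x_norm : forall j, op_norm (x j) <= r.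
Hypothesis km : 0 < k <= m%:R.
Variables (tr : (H -> H) -> R[i]) (htr : nff_trace ip N tr).
Hypothesis tr_dom : forall (y : H -> H) (p : R), N y -> 1 <= p ->
  nc_Lnorm ip tr +oo%E y <= nc_Lnorm ip tr p%:E y.

(** Markov's inequality for the [p]-th power of the norm; the assumption on [a]
    says that the moment bound is smaller than [a] by a factor [exp(1/2)]. *)
Lemma sampled_tail_le (p a : R) : 5 / 2 <= p -> 0 < a ->
  4 * Num.max (Num.sqrt (p * r / k)) (p * r / k) <= a * expR (- (1 / 2)) ->
  bern_mean (k / m%:R) (fun J => (a < op_norm (sampled x k J))%R%:R) <=
  re_tau tr idfun * expR (- (p / 2)).
Proof.
move=> p52 a0 Ma; have p0 : 0 < p by lra.
set M := 4 * _ in Ma.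
have M0 : 0 <= M by rewrite mulr_ge0 // le_max sqrtr_ge0.
have ap0 : 0 < a `^ p by exact: powR_gt0.
have markov J : (a < op_norm (sampled x k J))%R%:R <=
    (a `^ p)^-1 * nc_Lnorm ip tr p%:E (sampled x k J) `^ p.
  case: ltP => [aJ|_] /=; last by rewrite mulr_ge0 ?invr_ge0 ?powR_ge0.
  rewrite mulrC ler_pdivlMr // mul1r; apply: ge0_ler_powR; first exact: ltW.
  - by rewrite nnegrE ltW.
  - by rewrite nnegrE; exact: powR_ge0.
  apply/ltW/(lt_le_trans aJ).
  have Ns := sampled_in_vna H_nontrivial hN x_pos x_mean km J.
  by apply: (tr_dom Ns); lra.
apply: le_trans (bern_mean_le (selection_rate01 km) markov) _.
rewrite bern_meanZ mulrC ler_pdivrMr //.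
have := sampled_Lnorm_le ip_norm H_nontrivial hN x_pos x_mean x_norm km htr p52.
rewrite -/M => /le_trans; apply.
rewrite mulrC -mulrA ler_wpM2l ?(re_tau1_ge0 ip_norm hN htr) //.
have -> : expR (- (p / 2)) = expR (- (1 / 2)) `^ p.
  by rewrite -expRM; congr expR; ring.
rewrite mulrC -powRM ?expR_ge0 ?(ltW a0) //.
apply: ge0_ler_powR; rewrite ?(ltW p0) // nnegrE.
by rewrite mulr_ge0 ?expR_ge0 ?(ltW a0).
Qed.

End Tail.

Lemma expR1_sqr_half (R : realType) : expR 1 = expR (1 / 2) ^+ 2 :> R.
Proof. by rewrite -expRM_natl; congr expR; lra. Qed.

Lemma max_sqrt_le (R : realType) (y b : R) : 0 <= y -> y <= b ^+ 2 -> y <= b ->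
  0 <= b -> 4 * Num.max (Num.sqrt y) y <= 4 * b.
Proof.
move=> y0 yb2 yb b0; rewrite ler_pM2l // ge_max yb andbT.
by rewrite -(ger0_norm b0) -sqrtr_sqr ler_sqrt // sqr_ge0.
Qed.

Theorem corollary0p5 (R : realType) :
  exists C : R, 0 < C /\
  forall (H : completeNormedModType R[i]) (ip : {dot H for (@Num.conj R[i])})
    (N : set (H -> H)) (tau : (H -> H) -> R[i])
    (m : nat) (x : 'I_m -> H -> H) (r k : R)
    (d : measure_display) (T : measurableType d) (P : probability T R)
    (delta : 'I_m -> {RV P >-> R}),
  (forall v : H, ip v v = `|v| ^+ 2) ->
  von_neumann_algebra ip N ->
  nff_trace ip N tau -> normalized tau ->
  (forall j, N (x j) /\ positive_op ip (x j)) ->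
  (m%:R^-1 : R[i]) *: (\sum_(j < m) x j) = idfun ->
  (forall j, op_norm (x j) <= r) ->
  0 < k <= m%:R ->
  (forall j, selector (delta j)) ->
  independent delta ->
  (forall j, 'E_P[delta j] = (k / m%:R)%:E)%E ->
  let Y := fun w => sample_dev k x (fun j => delta j w) in
  (forall p : R, 5 / 2 <= p ->
     (poweR 'E_P[fun w => powR (nc_Lnorm ip tau p%:E (Y w)) p] p^-1 <=
      (C * Num.max (Num.sqrt (p * r / k)) (p * r / k))%:E)%E)
  /\
  (forall (tr : (H -> H) -> R[i]) (eps t : R),
     nff_trace ip N tr ->
     (forall (y : H -> H) (p : R), N y -> 1 <= p ->
        nc_Lnorm ip tr +oo%E y <= nc_Lnorm ip tr p%:E y) ->
     r / k = eps ^+ 2 -> 0 < eps -> 0 < t ->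
     5 / 2 * C ^+ 2 * expR 1 <= t ^+ 2 ->
     5 / 2 * C * expR 1 * eps <= t ->
     let tail := P [set w | t * eps < nc_Lnorm ip tr +oo%E (Y w)] in
     (t * eps <= C ->
        (tail <= (complex.Re (tr idfun)
                  * expR (- (t ^+ 2 / (2 * C ^+ 2 * expR 1))))%:E)%E)
     /\
     (C <= t * eps ->
        (tail <= (complex.Re (tr idfun)
                  * expR (- (t / (2 * C * expR 1 * eps))))%:E)%E)).
Proof.
exists 4; split=> //.
move=> H ip N tau m x r k d T P delta ip_norm hN htau tau1 x_pos x_mean x_norm km
  delta_sel delta_ind delta_mean Y.
have H_nontrivial : (idfun : H -> H) <> 0.
  move=> id0; have N0 : N 0 by rewrite -id0; exact: vna_unit hN.
  have := trace_lin htau (-1) N0 N0.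
  rewrite scaler0 addr0 mulN1r addNr -id0 tau1 => /eqP.
  by rewrite oner_eq0.
have YE w : Y w = sampled x k (selected delta w).
  rewrite /Y /sampled; congr (sample_dev k x _).
  by apply/funext => j; exact: selected_val.
split.
  move=> p p52; have p0 : 0 < p by lra.
  pose G J := nc_Lnorm ip tau p%:E (sampled x k J) `^ p.
  have -> : (fun w => nc_Lnorm ip tau p%:E (Y w) `^ p) =
            (fun w => G (selected delta w)).
    by apply/funext => w; rewrite YE.
  rewrite (expectation_selected delta_sel delta_ind delta_mean (G := G)); last first.
    by move=> J; exact: powR_ge0.
  rewrite poweR_EFin lee_fin; set M := 4 * _.
  have M0 : 0 <= M by rewrite mulr_ge0 // le_max sqrtr_ge0.
  have := sampled_Lnorm_le ip_norm H_nontrivial hN x_pos x_mean x_norm km htau p52.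
  rewrite -/M /re_tau tau1 mulr1 => EM.
  have -> : M = (M `^ p) `^ p^-1.
    by rewrite -powRrM divff ?gt_eqF // powRr1.
  apply: ge0_ler_powR; rewrite ?nnegrE ?powR_ge0 ?invr_ge0 ?(ltW p0) //.
  rewrite -(bern_mean_cst 'I_m (k / m%:R) 0).
  by apply: bern_mean_le => [|J]; [exact: selection_rate01 | exact: powR_ge0].
move=> tr eps t htr tr_dom rk eps0 t0 t_sqr t_eps tail.
have te0 : 0 < t * eps by rewrite mulr_gt0.
have tailE : tail = (bern_mean (k / m%:R)
    (fun J => (t * eps < op_norm (sampled x k J))%R%:R))%:E.
  rewrite -(prob_selected_in delta_sel delta_ind delta_mean).
  by congr (P _); apply/seteqP; split=> w /=; rewrite YE.
have tail_le p : 5 / 2 <= p ->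
    4 * Num.max (Num.sqrt (p * eps ^+ 2)) (p * eps ^+ 2) <= t * eps * expR (- (1 / 2)) ->
    (tail <= (complex.Re (tr idfun) * expR (- (p / 2)))%:E)%E.
  move=> p52; rewrite -rk mulrA tailE lee_fin => pM.
  exact: (sampled_tail_le ip_norm H_nontrivial hN x_pos x_mean x_norm km htr tr_dom).
(* In terms of h = sqrt e, both choices of p make the p-th moment bound at most
   4 * (t * eps / (4 * h)), that is, a factor h below the threshold. *)
pose h : R := expR (1 / 2).
have h0 : 0 < h by exact: expR_gt0.
have h1 : 1 <= h by rewrite -expR0 ler_expR; lra.
have hE : expR 1 = h ^+ 2 :> R by exact: expR1_sqr_half.
have hV : expR (- (1 / 2)) = h^-1 by rewrite expRN.
rewrite hE in t_sqr t_eps *; rewrite hV in tail_le.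
have h2 : 0 < h ^+ 2 by rewrite exprn_gt0.
split=> [te_le|te_ge].
- pose p := t ^+ 2 / (4 ^+ 2 * h ^+ 2).
  have d0 : 0 < 4 ^+ 2 * h ^+ 2 by rewrite mulr_gt0.
  have -> : t ^+ 2 / (2 * 4 ^+ 2 * h ^+ 2) = p / 2.
    by rewrite /p; field; rewrite gt_eqF.
  apply: tail_le; first by rewrite ler_pdivlMr // mulrA.
  have -> : t * eps / h = 4 * (t * eps / (4 * h)) by field; rewrite gt_eqF.
  have yE : p * eps ^+ 2 = (t * eps / (4 * h)) ^+ 2.
    by rewrite /p; field; rewrite gt_eqF.
  have b0 : 0 <= t * eps / (4 * h) by rewrite divr_ge0 ?mulr_ge0 ?ltW.
  apply: max_sqrt_le; rewrite // yE ?sqr_ge0 // expr2 ler_piMr //.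
  by rewrite ler_pdivrMr ?mulr_gt0 // mul1r; lra.
- pose p := t / (4 * h ^+ 2 * eps).
  have d0 : 0 < 4 * h ^+ 2 * eps by rewrite !mulr_gt0.
  have -> : t / (2 * 4 * h ^+ 2 * eps) = p / 2.
    by rewrite /p; field; rewrite !gt_eqF.
  apply: tail_le; first by rewrite /p ler_pdivlMr //; lra.
  have -> : t * eps / h = 4 * (t * eps / (4 * h)) by field; rewrite gt_eqF.
  have yE : p * eps ^+ 2 = t * eps / (4 * h ^+ 2).
    by rewrite /p; field; rewrite !gt_eqF.
  have b0 : 0 <= t * eps / (4 * h) by rewrite divr_ge0 ?mulr_ge0 ?ltW.
  apply: max_sqrt_le; rewrite // yE.
  + by rewrite divr_ge0 ?mulr_ge0 ?ltW.
  + rewrite -subr_ge0.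
    have -> : (t * eps / (4 * h)) ^+ 2 - t * eps / (4 * h ^+ 2) =
        t * eps * (t * eps - 4) / (16 * h ^+ 2) by field; rewrite gt_eqF.
    apply: divr_ge0; last by rewrite ltW // mulr_gt0.
    by rewrite mulr_ge0 ?(ltW te0) // subr_ge0.
  + rewrite ler_pM2l // lef_pV2 ?posrE ?mulr_gt0 // ler_pM2l // expr2.
    by rewrite ler_peMl // ltW.
Qed.
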